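(* Consider an expander family of graphs $G=(V,E)$, $|V|=n$, satisfying $\lambda=o(1)$ and $d_{\max}/d_{\min}=1+o(1)$ as $n\to\infty$. For the 2-choices dynamics with node failures with failure probability $\alpha\in(0,1)$ on these graphs, the following hold. 1. Fix $0<\alpha<\frac13$ and choose any $\epsilon>0$. Then $t_{\mathrm{mix}}=\Omega(\exp(\Theta(n)))$, and for any $p\in[0,1/2-\epsilon)\cup(1/2+\epsilon,1]$ we have $T_{1/2}=\Omega(\exp(\Theta(n)))$ with high probability given that $A(\mathbf X(0))=\lceil np\rceil$. 2. Fix $\alpha>1/3$ and choose any $\epsilon>0$. Then the hitting time $\tau$ to the set $$\left\{\mathbf x:\ A(\mathbf x)=\left\lceil\tfrac n2(1+\epsilon)\right\rceil\ \text{ or }\ A(\mathbf x)=\left\lfloor\tfrac n2(1-\epsilon)\right\rfloor\right\}$$ satisfies $\mathbb{E}_{\mathbf x}[\tau]=O(\log n)$ for any initial state $\mathbf x\in\{0,1\}^n$.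
   Context: 2-choices dynamics with node failures: let $G=(V,E)$ be a simple, undirected, connected graph with $|V|=n$. Each node $v$ holds an opinion $X_v(t)\in\{0,1\}$ at time $t\geq 0$ and updates at the points of an independent unit-rate Poisson process. At an update, with probability $1-\alpha$ the node samples two neighbours uniformly at random with replacement and, if they have the same opinion, adopts it (otherwise it keeps its own opinion); with probability $\alpha$ it adopts one of the two opinions $0,1$ uniformly at random, independently of any node's opinion. Then $\mathbf X=(\mathbf X(t))_{t\ge0}$, $\mathbf X(t)=(X_v(t))_{v\in V}$, is an ergodic continuous-time Markov chain on $\mathcal X=\{0,1\}^n$ with unique stationary distribution $\boldsymbol\pi$. For $\mathbf x\in\mathcal X$, $A(\mathbf x)$ is the number of nodes with opinion $1$ in $\mathbf x$; $\mathbb{P}_{\mathbf x},\mathbb{E}_{\mathbf x}$ denote probability and expectation conditioned on $\mathbf X(0)=\mathbf x$; $T_{1/2}=\inf\{t\ge0:A(\mathbf X(t))=\lceil n/2\rceil\text{ or }A(\mathbf X(t))=\lfloor n/2\rfloor\}$. Mixing time: $t_{\mathrm{mix}}=\inf\{t\ge0: d(t)\le 1/4\}$, where $d(t)=\max_{\mathbf x\in\mathcal X}\max_{\Gamma\subseteq\mathcal X}|\mathbb{P}_{\mathbf x}(\mathbf X(t)\in\Gamma)-\boldsymbol\pi(\Gamma)|$. Graph parameters: $d_{\max},d_{\min}$ are the maximum and minimum degrees of $G$. Let $\mathbf M$ be the adjacency matrix and $\mathbf D$ the diagonal degree matrix; the eigenvalues of $\mathbf D^{-1}\mathbf M$ are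 real, $1=\lambda_1\ge\lambda_2\ge\dots\ge\lambda_n$, and $\lambda=\max_{2\le j\le n}|\lambda_j|$. An expander family is a family of graphs with increasing $n$ whose spectral gap $1-\lambda$ stays bounded away from $0$. Asymptotic notation ($O$, $o$, $\Omega$, $\Theta$) is as $n\to\infty$; an event occurs with high probability given another if its conditional probability tends to $1$ as $n\to\infty$.
   Formalization: In part 2 the bound on τ is stated only for initial states not strictly between the two levels (from inside, τ is exponentially large, and infinite for ε>1); for every initial state the O(log n) bound is stated for hitting the whole band between the two levels. *)

(* Defs.v *)
From HB Require Import structures.
From mathcomp Require Import all_boot all_order all_algebra.
From mathcomp Require Import all_classical all_reals all_analysis.

Set Implicit Arguments.
Unset Strict Implicit.
Unset Printing Implicit Defensive.

Import Order.TTheory GRing.Theory Num.Theory.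
Import numFieldNormedType.Exports.

Local Open Scope classical_set_scope.
Local Open Scope ring_scope.

(** * Graphs, given by their adjacency relation *)

Definition simple_connected_graph (V : finType) (e : rel V) : Prop :=
  [/\ symmetric e, irreflexive e & forall v w : V, connect e v w].

Definition degree (V : finType) (e : rel V) (v : V) : nat := #|[set w | e v w]%SET|.

Definition max_degree (V : finType) (e : rel V) : nat :=
  (\max_(v : V) degree e v)%N.

(* The default value #|V| exceeds every degree of a simple graph, so it only
   matters when V is empty. *)
Definition min_degree (V : finType) (e : rel V) : nat :=
  \big[minn/#|V|]_(v : V) degree e v.

Definition adjacency_mx (R : realType) (V : finType) (e : rel V) : 'M[R]_#|V| :=
  \matrix_(i, j) (e (enum_val i) (enum_val j))%:R.

Definition degree_mx (R : realType) (V : finType) (e : rel V) : 'M[R]_#|V| :=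
  diag_mx (\row_i (degree e (enum_val i))%:R).

(* The eigenvalues of A with multiplicity, in nonincreasing order; meaningful
   when the characteristic polynomial of A splits over R (otherwise [::]). *)
Definition spectrum (R : realType) (m : nat) (A : 'M[R]_m) : seq R :=
  xget [::] [set s | sorted >=%R s /\
                     char_poly A = \prod_(z <- s) ('X - z%:P)].

(* max |lambda_j| over 2 <= j <= n *)
Definition second_eigenvalue (R : realType) (V : finType) (e : rel V) : R :=
  \big[Num.max/0]_(z <- behead (spectrum (invmx (degree_mx R e) *m
                                          adjacency_mx R e))) `|z|.

(* The condition 1 < #|V k| guarantees that every node has a neighbour. *)
Definition expander_family (R : realType) (V : nat -> finType)
    (e : forall k, rel (V k)) : Prop :=
  [/\ forall k, (1 < #|V k|)%N /\ simple_connected_graph (e k),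
      {homo (fun k => #|V k|) : i j / (i < j)%N} &
      exists2 delta : R, 0 < delta &
        forall k, delta <= 1 - second_eigenvalue R (e k)].

(** * Independence and Poisson processes *)

Definition events_of (Omega T : Type) (Y : Omega -> T) : set (set Omega) :=
  [set Y @^-1` B | B in [set: set T]].

Definition mutually_independent (R : realType) (d : measure_display)
    (Omega : measurableType d) (P : probability Omega R)
    (I : eqType) (F : I -> set (set Omega)) : Prop :=
  forall (J : seq I) (E : I -> set Omega), uniq J ->
    (forall i, i \in J -> F i (E i)) ->
    P (\big[setI/setT]_(i <- J) E i) = (\prod_(i <- J) P (E i))%E.

Definition increment (R : realType) (Omega : Type) (N : R -> Omega -> nat)
    (s t : R) : Omega -> nat := fun w => (N t w - N s w)%N.

(* The counting process of a unit-rate Poisson process. Independence of the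
   increments is not included: it is required jointly with the independence of
   the other sources of randomness in [driving_noise]. The case s = t is
   excluded because [poisson_pmf 0] is not a probability mass function. *)
Definition unit_poisson_marginals (R : realType) (d : measure_display)
    (Omega : measurableType d) (P : probability Omega R)
    (N : R -> Omega -> nat) : Prop :=
  [/\ forall w, N 0 w = 0%N,
      forall w s t, 0 <= s <= t -> (N s w <= N t w)%N,
      forall w t, 0 <= t -> \forall s \near t^'+, N s w = N t w,
      forall t j, 0 <= t -> measurable (N t @^-1` [set j]) &
      forall s t j, 0 <= s < t ->
        P (increment N s t @^-1` [set j]) = (poisson_pmf (t - s) j)%:E].

(** * The 2-choices dynamics with node failures *)

Notation state V := {ffun V -> bool}.

Definition count_ones (V : finType) (x : state V) : nat := #|[set v | x v]%SET|.

(* What a node draws at an update: either the two sampled neighbours, or, in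
   case of failure, the opinion that it adopts. *)
Notation draw V := ((V * V) + bool)%type.

Definition draw_pmf (R : realType) (V : finType) (e : rel V) (alpha : R)
    (v : V) (m : draw V) : R :=
  match m with
  | inl (w1, w2) => (1 - alpha) * ((e v w1)%:R / (degree e v)%:R)
                                * ((e v w2)%:R / (degree e v)%:R)
  | inr _ => alpha * 2^-1
  end.

Definition updated_opinion (V : finType) (v : V) (m : draw V) (x : state V) :
    bool :=
  match m with
  | inl (w1, w2) => if x w1 == x w2 then x w1 else x v
  | inr b => b
  end.

(* N v t is the number of updates of node v during [0, t], and M v i is what
   node v draws at its i-th update (i >= 1). The increments of all the N v over
   the consecutive intervals of any subdivision and all the draws M v i are
   mutually independent. *)
Definition driving_noise (R : realType) (V : finType) (e : rel V) (alpha : R)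
    (d : measure_display) (Omega : measurableType d) (P : probability Omega R)
    (N : V -> R -> Omega -> nat) (M : V -> nat -> Omega -> draw V) : Prop :=
  [/\ forall v, unit_poisson_marginals P (N v),
      forall v i m, measurable (M v i @^-1` [set m]),
      forall v i m, P (M v i @^-1` [set m]) = (draw_pmf e alpha v m)%:E &
      forall t : nat -> R, 0 <= t 0%N -> {homo t : i j / (i <= j)%N >-> i <= j} ->
        mutually_independent P (fun a : (V * nat) + (V * nat) =>
          match a with
          | inl (v, j) => events_of (increment (N v) (t j) (t j.+1))
          | inr (v, i) => events_of (M v i)
          end)].

(* Node v keeps its opinion between its updates; at an update time t it applies
   the update rule to the configuration just before time t. *)
Definition evolves_by (R : realType) (V : finType) (N : V -> R -> nat)
    (M : V -> nat -> draw V) (X : R -> state V) : Prop :=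
  forall v t, 0 < t ->
    (forall s, 0 <= s <= t -> N v s = N v t -> X t v = X s v) /\
    ((forall s, 0 <= s < t -> (N v s < N v t)%N) ->
       \forall s \near t^'-, X t v = updated_opinion v (M v (N v t)) (X s)).

(* Under P, the process X is the dynamics started from the configuration x. *)
Definition two_choices (R : realType) (V : finType) (e : rel V) (alpha : R)
    (d : measure_display) (Omega : measurableType d) (P : probability Omega R)
    (x : state V) (X : R -> Omega -> state V) : Prop :=
  [/\ forall t y, 0 <= t -> measurable (X t @^-1` [set y]),
      P (X 0 @^-1` [set x]) = 1%E &
      exists (N : V -> R -> Omega -> nat) (M : V -> nat -> Omega -> draw V),
        driving_noise e alpha P N M /\
        forall w, evolves_by (fun v t => N v t w) (fun v i => M v i w)
                             (fun t => X t w)].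

(** * Stationary distribution, mixing time, hitting times *)

(* Below, P x is the law under which X starts from x. *)

Definition transition (R : realType) (V : finType) (d : measure_display)
    (Omega : measurableType d) (P : state V -> probability Omega R)
    (X : R -> Omega -> state V) (t : R) (x : state V) (S : {set state V}) : R :=
  fine (P x (X t @^-1` [set` S])).

Definition stationary_distribution (R : realType) (V : finType)
    (d : measure_display) (Omega : measurableType d)
    (P : state V -> probability Omega R) (X : R -> Omega -> state V)
    (pi : state V -> R) : Prop :=
  [/\ forall x, 0 <= pi x,
      \sum_x pi x = 1 &
      forall t y, 0 <= t ->
        \sum_x pi x * transition P X t x [set y]%SET = pi y].

Definition distance_to_stationarity (R : realType) (V : finType)
    (d : measure_display) (Omega : measurableType d)
    (P : state V -> probability Omega R) (X : R -> Omega -> state V)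
    (pi : state V -> R) (t : R) : R :=
  \big[Num.max/0]_(x : state V) \big[Num.max/0]_(S : {set state V})
    `|transition P X t x S - \sum_(y in S) pi y|.

(* +oo if the distance never gets below 1/4 *)
Definition mixing_time (R : realType) (V : finType) (d : measure_display)
    (Omega : measurableType d) (P : state V -> probability Omega R)
    (X : R -> Omega -> state V) (pi : state V -> R) : \bar R :=
  ereal_inf [set t%:E | t in
    [set t : R | 0 <= t /\ distance_to_stationarity P X pi t <= 4^-1]].

(* +oo on the paths that never visit S *)
Definition hitting_time (R : realType) (V : finType) (Omega : Type)
    (X : R -> Omega -> state V) (S : set (state V)) (w : Omega) : \bar R :=
  ereal_inf [set t%:E | t in [set t : R | 0 <= t /\ S (X t w)]].

Definition half_level (V : finType) : set (state V) :=
  [set x | count_ones x = uphalf #|V| \/ count_ones x = #|V|./2].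

Definition upper_level (R : realType) (V : finType) (eps : R) : int :=
  Num.ceil (#|V|%:R / 2 * (1 + eps) : R).

Definition lower_level (R : realType) (V : finType) (eps : R) : int :=
  Num.floor (#|V|%:R / 2 * (1 - eps) : R).

Definition band_boundary (R : realType) (V : finType) (eps : R) :
    set (state V) :=
  [set x | (count_ones x)%:Z = upper_level V eps \/
           (count_ones x)%:Z = lower_level V eps].

Definition band (R : realType) (V : finType) (eps : R) : set (state V) :=
  [set x | lower_level V eps <= (count_ones x)%:Z <= upper_level V eps].

(* From these configurations the band is entered through its boundary levels;
   strictly between the levels, the hitting times of the boundary and of the
   band differ. *)
Definition outside_band (R : realType) (V : finType) (eps : R) :
    set (state V) :=
  [set x | (count_ones x)%:Z <= lower_level V eps \/
           upper_level V eps <= (count_ones x)%:Z].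

(** * Asymptotic notation along a family of sizes n k -> oo *)

(* One-sided: [=Theta_] of the library would also allow negative functions g,
   for which exp(g) does not grow. *)
Definition pos_Theta (R : realType) (n : nat -> nat) (g : nat -> R) : Prop :=
  exists a b : R, [/\ 0 < a, 0 < b &
    \forall k \near \oo, a * (n k)%:R <= g k <= b * (n k)%:R].

Definition Omega_exp_Theta (R : realType) (n : nat -> nat)
    (u : nat -> \bar R) : Prop :=
  exists (g : nat -> R) (c : R), [/\ pos_Theta n g, 0 < c &
    \forall k \near \oo, ((c * expR (g k))%:E <= u k)%E].

(* Main.v *)
Require Import Defs.
From HB Require Import structures.
From mathcomp Require Import all_boot all_order all_algebra.
From mathcomp Require Import all_classical all_reals all_analysis.
From mathcomp Require Import spectral complex ring lra.

Import Order.TTheory GRing.Theory Num.Theory.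
Import numFieldNormedType.Exports.

(* The number A_b of nodes with opinion b changes at rates that depend on the
   graph only through the fractions of neighbours with opinion b. As lambda
   tends to 0 and the degrees are nearly constant, these fractions concentrate
   in mean square around A_b / n, so that the drift of A_b is n G(A_b / n) + o(n)
   with G(p) = (1 - 2p)(alpha / 2 - (1 - alpha) p (1 - p)).

   For alpha < 1/3, G is negative on an interval to the left of 1/2, and
   exp(theta A_b) is a supermartingale there for a small theta: crossing the
   interval takes exponential time. Two copies of the chain started from the two
   consensus states stay apart for that long, which bounds the mixing time.

   For alpha > 1/3, G(p) <= - c for p >= (1 + eps) / 2, so A_b decays
   exponentially until it reaches the band and E[tau] is even bounded.

   Stochastic calculus is avoided by cutting [0, T] into L cells: outside an
   event of probability at most (nT)^2 / L every cell contains at most one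
   update, the probability of each sequence of updates is explicit, and sums over
   such sequences are controlled by the generator; then L tends to infinity. *)

Set Implicit Arguments.
Unset Strict Implicit.
Unset Printing Implicit Defensive.

Local Open Scope classical_set_scope.
Local Open Scope ring_scope.

(** * Spectral contraction *)

Local Open Scope sesquilinear_scope.

(** The process is given only pathwise, by Poisson clocks and draws that are independent along any
    subdivision of time; no Markov property or semigroup comes with it. A grid turns this into
    finitely many independent conditions, and two inductions over words of cell moves take the place
    of optional stopping. The count A_b is not a Markov chain, since its rates depend on the whole
    configuration, so each drift bound must hold for all configurations with a given count; the
    spectral estimate provides this uniformity. Estimates are made for an arbitrary opinion b
    because the two sides of the majority level mirror each other. *)

Lemma char_poly_similar (F : fieldType) n (P A B : 'M[F]_n) :
  P \in unitmx -> P *m A = B *m P -> char_poly A = char_poly B.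
Proof.
move=> Pu PA; have dP : (\det P)%:P != 0 :> {poly F}.
  by rewrite polyC_eq0 -unitfE -unitmxE.
apply: (mulfI dP); rewrite [RHS]mulrC -det_map_mx /char_poly -!det_mulmx.
congr (\det _); rewrite /char_poly_mx mulmxBr mulmxBl -!map_mxM PA.
by rewrite scalar_mxC.
Qed.

Lemma char_poly_spectral (C : numClosedFieldType) n (A : 'M[C]_n) :
  A \is hermsymmx ->
  char_poly A = \prod_(i < n) ('X - (spectral_diag A 0 i)%:P).
Proof.
move=> /hermitian_normalmx /orthomx_spectralP A_eq.
have Pu := spectral_unit A.
rewrite (@char_poly_similar _ _ (spectralmx A) A (diag_mx (spectral_diag A))) //.
  rewrite char_poly_trig; last exact/is_diag_mx_is_trig/diag_mx_is_diag.
  by apply: eq_bigr => i _; rewrite mxE eqxx mulr1n.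
by rewrite {2}A_eq !mulmxA mulmxV // mul1mx.
Qed.

(** In an orthonormal eigenbasis A is diagonal; orthogonality to u removes the coordinate of the
    eigenvalue 1, and every other eigenvalue has modulus at most l. The eigenvalues enter as a list
    of roots without its head, the form in which [second_eigenvalue] provides them. *)
Lemma hermitian_contraction (C : numClosedFieldType) n (A : 'M[C]_n)
    (s : seq C) (l : C) (u g : 'rV[C]_n) :
  A \is hermsymmx -> char_poly A = \prod_(z <- s) ('X - z%:P) ->
  0 <= l < 1 -> {in behead s, forall z, `|z| <= l} ->
  u != 0 -> u *m A = u -> \sum_i g 0 i * (u 0 i)^* = 0 ->
  \sum_i `|(g *m A) 0 i| ^+ 2 <= l ^+ 2 * \sum_i `|g 0 i| ^+ 2.
Proof.
move=> Ah cpA /andP[l0 l1] sl u0 uA gu.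
have normE (x : 'rV[C]_n) : \sum_i `|x 0 i| ^+ 2 = (x *m x^t*) 0 0.
  by rewrite mxE; apply: eq_bigr => i _; rewrite !mxE normCK.
have dotE (x y : 'rV[C]_n) : (x *m y^t*) 0 0 = \sum_i x 0 i * (y 0 i)^*.
  by rewrite mxE; apply: eq_bigr => i _; rewrite !mxE.
have A_eq := orthomx_spectralP (hermitian_normalmx Ah).
pose P := spectralmx A; pose D := spectral_diag A.
have PU : P \is unitarymx by exact: spectral_unitarymx.
have Pu : P \in unitmx := spectral_unit A.
have PV : invmx P = P^t* by rewrite invmx_unitary.
pose co (x : 'rV[C]_n) := x *m invmx P.
have coK x : co x *m P = x by rewrite /co -mulmxA mulVmx // mulmx1.
have dot_co x y : (x *m y^t*) 0 0 = \sum_i co x 0 i * (co y 0 i)^*.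
  rewrite -dotE; congr (fun M : 'M[C]_1 => M 0 0).
  rewrite -{1}[x]coK -{1}[y]coK trmx_mul map_mxM /= -!mulmxA.
  by rewrite (mulmxA P (P^t*)) (unitarymxP PU) mul1mx.
have coA x i : co (x *m A) 0 i = co x 0 i * D 0 i.
  by rewrite /co A_eq !mulmxA mulmxK // mul_mx_diag mxE.
(* Some diagonal entry is 1, and the head of s must be 1 as well: otherwise 1
   would lie in the tail of s, against l < 1. Hence all the other diagonal
   entries lie in the tail. *)
have perm_s : perm_eq s [seq D 0 i | i <- enum 'I_n].
  apply: prod_XsubC_eq; rewrite -cpA char_poly_spectral // big_map.
  by rewrite big_enum.
have [i0 ci0] : exists i, co u 0 i != 0.
  apply/existsP; apply: contraNT u0; rewrite negb_exists => /forallP cu.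
  rewrite -(coK u) (_ : co u = 0) ?mul0mx //.
  by apply/rowP => i; move: (cu i); rewrite negbK => /eqP ->; rewrite mxE.
have Di0 : D 0 i0 = 1.
  by apply: (mulfI ci0); rewrite -coA uA mulr1.
have n1l : ~~ (`|1 : C| <= l) by rewrite normr1 lt_geF.
have Dl i : i != i0 -> `|D 0 i| <= l.
  have i0e : i0 \in enum 'I_n by rewrite mem_enum.
  move=> ii0; apply: (sl); move: perm_s.
  rewrite (perm_sym s) => perm_s.
  have := perm_map (fun i => D 0 i) (perm_to_rem i0e).
  rewrite perm_sym => /perm_trans /(_ perm_s) /=; rewrite Di0.
  case: s sl {perm_s cpA} => [|h t] /= sl ps; first by have := perm_size ps.
  have h1 : h = 1.
    apply/eqP; move: (perm_mem ps 1); rewrite !inE eqxx /= eq_sym => /esym.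
    by case/orP => // /sl; rewrite (negPf n1l).
  move: ps; rewrite h1 perm_cons => /perm_mem <-; apply: map_f.
  by rewrite mem_rem_uniq ?enum_uniq // inE ii0 mem_enum.
(* The other eigenvalues differ from 1, so u has no component along them; orthogonality to u then
   says that the coordinate i0 of g vanishes. *)
have cu i : i != i0 -> co u 0 i = 0.
  move=> /Dl Dil; apply/eqP; apply: contraTT Dil => cui.
  suff -> : D 0 i = 1 by [].
  by apply: (mulfI cui); rewrite -coA uA mulr1.
have cg0 : co g 0 i0 = 0.
  move: gu; rewrite -dotE dot_co (bigD1 i0) //= big1 => [|i /cu ->].
    by rewrite addr0 => /eqP; rewrite mulf_eq0 conjC_eq0 (negPf ci0) orbF => /eqP.
  by rewrite rmorph0 mulr0.
rewrite !normE !dot_co mulr_sumr; apply: ler_sum => i _.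
rewrite -!normCK coA normrM exprMn mulrC.
have [->|/Dl Dil] := eqVneq i i0; first by rewrite cg0 normr0 expr0n !mulr0.
by rewrite ler_wpM2r ?exprn_ge0 // lerXn2r // nnegrE.
Qed.

(** Over the complex numbers the spectral theorem applies and the eigenvalues are real. This shows
    that [spectrum] does not fall back on its default [[::]], for which [second_eigenvalue] would be
    0. *)
Lemma char_poly_real_split (R : realType) n (A : 'M[R]_n) : A^T = A ->
  exists s : seq R, sorted >=%R s /\ char_poly A = \prod_(z <- s) ('X - z%:P).
Proof.
move=> At; pose AC := map_mx (real_complex R) A.
have Ah : AC \is hermsymmx.
  apply: realsym_hermsym; last first.
    by apply/mxOverP => i j; rewrite mxE; apply/complex_realP; exists (A i j).
  apply/is_hermitianmxP; rewrite expr0 scale1r; apply/matrixP => i j.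
  by rewrite !mxE -{1}At mxE.
pose r := [seq complex.Re (spectral_diag AC 0 i) | i <- enum 'I_n].
exists (sort >=%R r); split.
  by apply: sort_sorted => x y; exact: le_total.
apply: (map_poly_inj (real_complex R)); rewrite map_char_poly.
rewrite char_poly_spectral // rmorph_prod /=.
have -> : \prod_(z <- sort >=%R r) map_poly (real_complex R) ('X - z%:P)
        = \prod_(z <- r) map_poly (real_complex R) ('X - z%:P).
  by apply: perm_big; rewrite perm_sort.
rewrite big_map big_enum; apply: eq_bigr => i _.
rewrite map_polyXsubC; congr ('X - _%:P); apply/esym/RRe_real.
exact: (mxOverP (hermitian_spectral_diag_real Ah)).
Qed.

Lemma symmetric_contraction (R : realType) n (A : 'M[R]_n)
    (s : seq R) (l : R) (u g : 'rV[R]_n) :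
  A^T = A -> char_poly A = \prod_(z <- s) ('X - z%:P) ->
  0 <= l < 1 -> {in behead s, forall z, `|z| <= l} ->
  u != 0 -> u *m A = u -> \sum_i g 0 i * u 0 i = 0 ->
  \sum_i (g *m A) 0 i ^+ 2 <= l ^+ 2 * \sum_i g 0 i ^+ 2.
Proof.
move=> At cpA /andP[l0 l1] sl u0 uA gu; pose C := real_complex R.
have normC (x : R) : `|C x| = C `|x|.
  by rewrite normc_def /= expr0n addr0 sqrtr_sqr.
have Ah : map_mx C A \is hermsymmx.
  apply: realsym_hermsym; last first.
    by apply/mxOverP => i j; rewrite mxE; apply/complex_realP; exists (A i j).
  apply/is_hermitianmxP; rewrite expr0 scale1r; apply/matrixP => i j.
  by rewrite !mxE -{1}At mxE.
have := @hermitian_contraction _ n (map_mx C A) (map C s) (C l)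
  (map_mx C u) (map_mx C g) Ah.
rewrite -map_char_poly cpA rmorph_prod big_map /= => /(_ _)/wrap[].
  by apply: eq_bigr => z _; rewrite map_polyXsubC.
rewrite -(rmorph0 C) -(rmorph1 C) lecR ltcR l0 l1 => /(_ isT)/(_ _)/wrap[].
  by rewrite behead_map => z /mapP[y /sl yl ->]; rewrite normC lecR.
rewrite map_mx_eq0 -map_mxM uA => /(_ u0 erefl)/(_ _)/wrap[].
  have conjR (x : R) : (C x)^* = C x.
    by apply/CrealP/complex_realP; exists x.
  under eq_bigr do rewrite !mxE conjR -rmorphM.
  by rewrite -rmorph_sum gu.
under eq_bigr do rewrite -map_mxM mxE normC -rmorphXn real_normK ?num_real //.
under [in X in _ <= X]eq_bigr do
  rewrite mxE normC -rmorphXn real_normK ?num_real //.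
by rewrite -!rmorph_sum -rmorphXn -rmorphM lecR.
Qed.

Local Close Scope sesquilinear_scope.

(** The random walk operator D^{-1} M applied to f. *)
Definition neighbor_mean (R : realType) (V : finType) (e : rel V) (f : V -> R)
    (v : V) : R := (\sum_w (e v w)%:R * f w) / (degree e v)%:R.

Lemma degreeE (R : pzSemiRingType) (V : finType) (e : rel V) v :
  (degree e v)%:R = \sum_w (e v w)%:R :> R.
Proof.
rewrite /degree -sum1_card natr_sum big_mkcond; apply: eq_bigr => w _.
by rewrite inE; case: (e v w).
Qed.

Lemma sum_enum_val (R : nmodType) (V : finType) (F : V -> R) :
  \sum_v F v = \sum_(i < #|V|) F (enum_val i).
Proof.
rewrite (reindex (@enum_val V predT)) //=.
by exists enum_rank => v _; rewrite ?enum_valK ?enum_rankK.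
Qed.

Section NeighborVariance.
Variables (R : realType) (V : finType) (e : rel V).
Hypotheses (e_sym : symmetric e) (deg_gt0 : forall v, (0 < degree e v)%N).

Let d (i : 'I_#|V|) : R := (degree e (enum_val i))%:R.
Let r i : R := Num.sqrt (d i).
Let d_gt0 i : 0 < d i. Proof. by rewrite ltr0n. Qed.
Let r_gt0 i : 0 < r i. Proof. by rewrite sqrtr_gt0. Qed.
Let r_neq0 i : r i != 0. Proof. by rewrite gt_eqF. Qed.
Let rr i : r i * r i = d i. Proof. by rewrite -expr2 sqr_sqrtr // ltW. Qed.

(* D^{-1/2} M D^{-1/2}, similar to D^{-1} M *)
Let A : 'M[R]_#|V| :=
  \matrix_(i, j) ((e (enum_val i) (enum_val j))%:R / (r i * r j)).

Let A_sym : A^T = A.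
Proof. by apply/matrixP => i j; rewrite !mxE e_sym mulrC [r j * _]mulrC mulrC. Qed.

Let char_poly_walk :
  char_poly (invmx (degree_mx R e) *m adjacency_mx R e) = char_poly A.
Proof.
have invD : invmx (degree_mx R e) = diag_mx (\row_i (d i)^-1).
  have DD : degree_mx R e *m diag_mx (\row_i (d i)^-1) = 1%:M.
    rewrite mulmx_diag; apply/matrixP => i j; rewrite !mxE.
    by rewrite -/(d i) divff // lt0r_neq0.
  have [Du _] := mulmx1_unit DD.
  by rewrite -[RHS](mulKmx Du) DD mulmx1.
have SS : diag_mx (\row_i r i) *m diag_mx (\row_i (r i)^-1) = 1%:M.
  by rewrite mulmx_diag; apply/matrixP => i j; rewrite !mxE divff.
have [Su _] := mulmx1_unit SS.
apply: (char_poly_similar Su); apply/matrixP => i j.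
rewrite invD mulmxA mulmx_diag mul_diag_mx mul_mx_diag !mxE -rr.
by field; rewrite !r_neq0.
Qed.

Lemma second_eigenvalue_ge0 : 0 <= second_eigenvalue R e.
Proof.
by rewrite /second_eigenvalue; elim/big_ind: _ => // x y; rewrite le_max => ->.
Qed.

(** D^{-1} M is self-adjoint for the degree weights and fixes the constants; subtracting the
    degree-weighted mean m makes f orthogonal to them. Conjugation by D^{1/2} reduces this to
    [symmetric_contraction] with u = D^{1/2} 1 and g = D^{1/2} (f - m). *)
Lemma neighbor_variance (f : V -> R) (m : R) :
  second_eigenvalue R e < 1 ->
  m = (\sum_v (degree e v)%:R * f v) / \sum_v (degree e v)%:R ->
  \sum_v (degree e v)%:R * (neighbor_mean e f v - m) ^+ 2 <=
  second_eigenvalue R e ^+ 2 * \sum_v (degree e v)%:R * (f v - m) ^+ 2.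
Proof.
move=> l1 mE; have [V0|V0] := posnP #|V|.
  by rewrite !big1 ?mulr0 // => v; have := fintype0 v V0.
have sumd_neq0 : \sum_v (degree e v)%:R != 0 :> R.
  rewrite -natr_sum pnatr_eq0 -lt0n.
  have [v0 _] := card_gt0P V0; rewrite (bigD1 v0) //=.
  by rewrite addn_gt0 deg_gt0.
pose u : 'rV[R]_#|V| := \row_i r i.
pose g : 'rV[R]_#|V| := \row_i (r i * (f (enum_val i) - m)).
have deg_sum j : \sum_(i < #|V|) (e (enum_val i) (enum_val j))%:R = d j :> R.
  rewrite /d degreeE [RHS]sum_enum_val; apply: eq_bigr => i _.
  by rewrite e_sym.
have [s] := char_poly_real_split A_sym; rewrite -char_poly_walk => -[s_srt cps].
have [_ spE] := @xgetPex _ [::] [set s | sorted >=%R s /\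
    char_poly (invmx (degree_mx R e) *m adjacency_mx R e)
    = \prod_(z <- s) ('X - z%:P)] (ex_intro _ s (conj s_srt cps)).
have := @symmetric_contraction _ _ A _ (second_eigenvalue R e) u g A_sym.
rewrite -char_poly_walk => /(_ _ spE); rewrite second_eigenvalue_ge0 l1.
move=> /(_ isT)/(_ _)/wrap[].
  by move=> z zs; rewrite /second_eigenvalue; apply: le_bigmax_seq.
move=> /(_ _)/wrap[].
  have [v0 _] := card_gt0P V0; apply/eqP => /rowP /(_ (enum_rank v0)).
  by rewrite !mxE => /eqP; rewrite (negPf (r_neq0 _)).
move=> /(_ _)/wrap[].
  apply/rowP => j; rewrite !mxE.
  under eq_bigr => i _ do rewrite !mxE.
  rewrite (eq_bigr (fun i => (e (enum_val i) (enum_val j))%:R * (r j)^-1)).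
    by rewrite -mulr_suml deg_sum -rr mulfK.
  by move=> i _; field; rewrite !r_neq0.
move=> /(_ _)/wrap[].
  under eq_bigr => i _ do rewrite !mxE mulrAC rr mulrBr.
  rewrite sumrB -mulr_suml -!(sum_enum_val (fun v => (degree e v)%:R)).
  rewrite -(sum_enum_val (fun v => (degree e v)%:R * f v)) mE.
  by rewrite mulrC divfK // subrr.
congr (_ <= _ * _).
  rewrite [RHS]sum_enum_val; apply: eq_bigr => j _; rewrite mxE.
  under eq_bigr => i _ do rewrite !mxE.
  rewrite (eq_bigr (fun i => ((e (enum_val i) (enum_val j))%:R * f (enum_val i)
      - m * (e (enum_val i) (enum_val j))%:R) * (r j)^-1)); last first.
    by move=> i _; field; rewrite !r_neq0.
  rewrite -mulr_suml sumrB -mulr_sumr deg_sum /neighbor_mean -/(d j).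
  rewrite (sum_enum_val (fun w => (e (enum_val j) w)%:R * f w)).
  under [in RHS]eq_bigr => i _ do rewrite e_sym.
  by rewrite -rr; field; rewrite r_neq0.
rewrite [RHS]sum_enum_val; apply: eq_bigr => j _.
by rewrite mxE exprMn -/(d j) -rr expr2.
Qed.

End NeighborVariance.

(** * Drift of the number of nodes with a given opinion *)

Definition count_of (V : finType) (b : bool) (x : state V) : nat :=
  #|[set v | x v == b]%SET|.

Lemma count_ofE (V : finType) b (x : state V) :
  count_of b x = (\sum_v (x v == b))%N.
Proof.
rewrite /count_of -sum1_card big_mkcond; apply: eq_bigr => v _.
by rewrite inE; case: (x v == b).
Qed.

Definition update (V : finType) (v : V) (m : draw V) (x : state V) : state V :=
  [ffun u => if u == v then updated_opinion v m x else x u].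

Definition generator (R : realType) (V : finType) (e : rel V) (alpha : R)
    (f : state V -> R) (x : state V) : R :=
  \sum_v \sum_m draw_pmf e alpha v m * (f (update v m x) - f x).

Definition has_op (R : realType) (V : finType) (b : bool) (x : state V) (v : V) : R :=
  (x v == b)%:R.

(** The rate at which [count_of b] increases: a node of the other opinion switches if both of its
    samples hold b, whence the square, or if it fails and adopts b. *)
Definition rate_to (R : realType) (V : finType) (e : rel V) (alpha : R)
    (b : bool) (x : state V) : R :=
  \sum_(v | x v != b)
    ((1 - alpha) * neighbor_mean e (has_op R b x) v ^+ 2 + alpha / 2).

(** The factored form of (1 - p) ((1 - alpha) p^2 + alpha / 2) - p ((1 - alpha) (1 - p)^2 + alpha /
    2), the drift if every node sees a fraction p of b. At p = 1/2 the second factor is (3 alpha -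
    1) / 4, which is the origin of the threshold 1/3. *)
Definition limit_drift (R : realType) (alpha p : R) : R :=
  (1 - 2 * p) * (alpha / 2 - (1 - alpha) * (p * (1 - p))).

Section Drift.
Variables (R : realType) (V : finType) (e : rel V) (alpha : R).
Hypotheses (alpha01 : 0 <= alpha <= 1) (deg_gt0 : forall v, (0 < degree e v)%N).
Implicit Types (x : state V) (b : bool) (v : V) (m : draw V).

Let deg_neq0 v : (degree e v)%:R != 0 :> R.
Proof. by rewrite pnatr_eq0 -lt0n. Qed.

Lemma draw_pmf_ge0 v m : 0 <= draw_pmf e alpha v m.
Proof.
case/andP: alpha01 => a0 a1; case: m => [[w1 w2]|b] /=.
  by rewrite !mulr_ge0 ?subr_ge0 ?invr_ge0 ?ler0n.
by rewrite mulr_ge0 // invr_ge0.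
Qed.

Lemma sum_draw (F : draw V -> R) :
  \sum_m F m = \sum_w1 \sum_w2 F (inl (w1, w2)) + (F (inr true) + F (inr false)).
Proof.
rewrite big_sumType /=; congr (_ + _); last by rewrite big_bool.
by rewrite pair_bigA; apply: eq_bigr => -[].
Qed.

Lemma neighbor_meanE (f : V -> R) v :
  neighbor_mean e f v = \sum_w (e v w)%:R / (degree e v)%:R * f w.
Proof.
by rewrite /neighbor_mean mulr_suml; apply: eq_bigr => w _; rewrite mulrAC.
Qed.

Lemma draw_pmf_prod (f : V -> R) v :
  \sum_w1 \sum_w2 draw_pmf e alpha v (inl (w1, w2)) * (f w1 * f w2) =
  (1 - alpha) * neighbor_mean e f v ^+ 2.
Proof.
rewrite expr2 neighbor_meanE mulr_suml mulr_sumr; apply: eq_bigr => w1 _.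
rewrite mulr_sumr mulr_sumr; apply: eq_bigr => w2 _ /=; ring.
Qed.

Lemma neighbor_mean1 v : neighbor_mean e (fun=> 1) v = 1 :> R.
Proof.
rewrite /neighbor_mean; under eq_bigr do rewrite mulr1.
by rewrite -degreeE divff.
Qed.

Lemma draw_pmf_sum1 v : \sum_m draw_pmf e alpha v m = 1.
Proof.
rewrite sum_draw.
transitivity ((1 - alpha) * neighbor_mean e (fun=> 1) v ^+ 2 + alpha).
  rewrite -draw_pmf_prod; congr (_ + _); last by rewrite /=; field.
  by apply: eq_bigr => w1 _; apply: eq_bigr => w2 _; rewrite !mulr1.
by rewrite neighbor_mean1 expr1n mulr1 subrK.
Qed.

(** The target is the opposite opinion, so disagreeing samples never produce it: both samples must
    hold it, and they are independent. *)
Lemma flip_rate x v :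
  \sum_m draw_pmf e alpha v m * (updated_opinion v m x == ~~ x v)%:R =
  (1 - alpha) * neighbor_mean e (has_op R (~~ x v) x) v ^+ 2 + alpha / 2.
Proof.
rewrite sum_draw -draw_pmf_prod; congr (_ + _).
  apply: eq_bigr => w1 _; apply: eq_bigr => w2 _; congr (_ * _).
  rewrite /has_op /=.
  by case: (x w1); case: (x w2); case: (x v); rewrite ?mulr1 ?mul0r ?mulr0.
by rewrite /=; case: (x v); rewrite ?mulr0 ?mulr1 ?addr0 ?add0r.
Qed.

Lemma count_of_update b x v m :
  count_of b (update v m x) =
  if updated_opinion v m x == x v then count_of b x
  else if x v == b then (count_of b x).-1 else (count_of b x).+1.
Proof.
have Ex : count_of b x = ((x v == b) + \sum_(u | u != v) (x u == b))%N.
  by rewrite count_ofE (bigD1 v).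
have -> : count_of b (update v m x) =
    ((updated_opinion v m x == b) + \sum_(u | u != v) (x u == b))%N.
  rewrite count_ofE (bigD1 v) //= ffunE eqxx; congr (_ + _)%N.
  by apply: eq_bigr => u uv; rewrite ffunE (negPf uv).
rewrite Ex {Ex}; move: (\sum_(u | u != v) _)%N => k.
by move: (updated_opinion v m x) (x v) => [] []; case: b.
Qed.

(** On functions of the count the dynamics act as a birth-death chain with configuration-dependent
    rates. At count 0 the predecessor is truncated, but the second rate is then an empty sum. *)
Lemma generator_count b (phi : nat -> R) x :
  generator e alpha (fun y => phi (count_of b y)) x =
  rate_to e alpha b x * (phi (count_of b x).+1 - phi (count_of b x)) +
  rate_to e alpha (~~ b) x * (phi (count_of b x).-1 - phi (count_of b x)).
Proof.
rewrite /generator (bigID (fun v => x v != b)) /=; congr (_ + _).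
  rewrite /rate_to mulr_suml; apply: eq_bigr => v xv.
  have bx : b = ~~ x v by move: xv; case: (x v); case: b.
  rewrite [X in has_op _ X]bx -flip_rate mulr_suml; apply: eq_bigr => m _.
  rewrite count_of_update (negPf xv) -mulrA; congr (_ * _).
  by case: (updated_opinion v m x); case: (x v); rewrite ?mul1r ?mul0r ?subrr.
rewrite /rate_to mulr_suml; apply: eq_big => [v|v xv].
  by case: (x v); case: b.
have bx : ~~ b = ~~ x v by move: xv; case: (x v); case: b.
rewrite [X in has_op _ X]bx -flip_rate mulr_suml; apply: eq_bigr => m _.
rewrite count_of_update -(negbK (x v == b)) (negPf xv) -mulrA; congr (_ * _).
by case: (updated_opinion v m x); case: (x v); rewrite ?mul1r ?mul0r ?subrr.
Qed.

End Drift.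

Section DriftEstimate.
Variables (R : realType) (V : finType) (e : rel V) (alpha : R).
Hypotheses (alpha01 : 0 <= alpha <= 1) (deg_gt0 : forall v, (0 < degree e v)%N).
Implicit Types (x : state V) (b : bool) (v : V).

Let n : R := #|V|%:R.

Lemma sum_has_op b x : \sum_v has_op R b x v = (count_of b x)%:R.
Proof. by rewrite count_ofE natr_sum. Qed.

Lemma has_opN b x v : has_op R (~~ b) x v = 1 - has_op R b x v.
Proof. by rewrite /has_op; case: (x v); case: b; rewrite ?subrr ?subr0. Qed.

Lemma count_ofN b x : (count_of (~~ b) x)%:R = n - (count_of b x)%:R :> R.
Proof.
rewrite -!sum_has_op; under eq_bigr do rewrite has_opN.
by rewrite sumrB sumr_const.
Qed.

Lemma count_of_le b x : (count_of b x)%:R <= n.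
Proof. by rewrite ler_nat; apply: max_card. Qed.

Lemma neighbor_mean_ge0 b x v : 0 <= neighbor_mean e (has_op R b x) v.
Proof.
by rewrite divr_ge0 ?ler0n // sumr_ge0 // => w _; rewrite mulr_ge0 ?ler0n.
Qed.

Lemma neighbor_meanN b x v :
  neighbor_mean e (has_op R (~~ b) x) v = 1 - neighbor_mean e (has_op R b x) v.
Proof.
rewrite -(neighbor_mean1 R deg_gt0 v) /neighbor_mean -mulrBl -sumrB.
by congr (_ / _); apply: eq_bigr => w _; rewrite has_opN mulrBr.
Qed.

Lemma neighbor_mean_le1 b x v : neighbor_mean e (has_op R b x) v <= 1.
Proof. by rewrite -subr_ge0 -neighbor_meanN neighbor_mean_ge0. Qed.

Lemma rate_to_ge0 b x : 0 <= rate_to e alpha b x.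
Proof.
case/andP: alpha01 => a0 a1; apply: sumr_ge0 => v _.
by rewrite addr_ge0 ?divr_ge0 // mulr_ge0 ?subr_ge0 // exprn_ge0 ?neighbor_mean_ge0.
Qed.

Lemma rate_to_le b x : rate_to e alpha b x <= n.
Proof.
case/andP: alpha01 => a0 a1.
have -> : n = \sum_(v : V) 1 by rewrite sumr_const.
rewrite /rate_to big_mkcond /=; apply: ler_sum => v _; case: ifP => // _.
have := neighbor_mean_ge0 b x v; have := neighbor_mean_le1 b x v.
by move: (neighbor_mean _ _ _) => q; nra.
Qed.

(** With every neighbour mean replaced by p, the rates differ by exactly n times [limit_drift];
    since squares are 2-Lipschitz on [0, 1], the replacement costs at most 2 |q_v - p| per node. *)
Lemma drift_error b x (p : R) : n * p = (count_of b x)%:R ->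
  `|rate_to e alpha b x - rate_to e alpha (~~ b) x - n * limit_drift alpha p|
  <= 2 * \sum_v `|neighbor_mean e (has_op R b x) v - p|.
Proof.
move=> pE; case/andP: alpha01 => a0 a1.
pose q v := neighbor_mean e (has_op R b x) v; pose h v := has_op R b x v.
have upE : rate_to e alpha b x =
    \sum_v (1 - h v) * ((1 - alpha) * q v ^+ 2 + alpha / 2).
  rewrite /rate_to big_mkcond; apply: eq_bigr => v _; rewrite /h /has_op.
  by case: (x v == b); rewrite /= ?subrr ?subr0 ?mul0r ?mul1r.
have downE : rate_to e alpha (~~ b) x =
    \sum_v h v * ((1 - alpha) * (1 - q v) ^+ 2 + alpha / 2).
  rewrite /rate_to big_mkcond; apply: eq_bigr => v _; rewrite /h /has_op.
  rewrite neighbor_meanN -/(q v).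
  by case: (x v); case: (b) => /=; rewrite ?mul0r ?mul1r.
have nE : n * limit_drift alpha p =
   \sum_v ((1 - h v) * ((1 - alpha) * p ^+ 2 + alpha / 2)
       - h v * ((1 - alpha) * (1 - p) ^+ 2 + alpha / 2)).
  rewrite sumrB -!mulr_suml sumrB sum_has_op -pE.
  by rewrite (_ : \sum_(v : V) 1 = n) ?sumr_const // /limit_drift; field.
rewrite upE downE nE -!sumrB mulr_sumr.
apply: (le_trans (ler_norm_sum _ _ _)); apply: ler_sum => v _.
have := neighbor_mean_ge0 b x v; have := neighbor_mean_le1 b x v.
rewrite -/(q v) => q1 q0.
have n0 : 0 < n by rewrite ltr0n; apply/card_gt0P; exists v.
have p0 : 0 <= p by rewrite -(pmulr_rge0 _ n0) pE ler0n.
have p1 : p <= 1 by rewrite -(ler_pM2l n0) pE mulr1 count_of_le.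
rewrite /h /has_op; case: (x v == b) => /=.
  rewrite (_ : _ - _ = (1 - alpha) * (2 - q v - p) * (q v - p)); last by ring.
  rewrite normrM ler_wpM2r // ger0_norm; nra.
rewrite (_ : _ - _ = (1 - alpha) * (q v + p) * (q v - p)); last by ring.
rewrite normrM ler_wpM2r // ger0_norm; nra.
Qed.

(** The spectral bound controls degree-weighted squares around the degree-weighted mean m. Nearly
    equal degrees serve twice: they put m within eps of p, and they allow the weights to be
    dropped. *)
Lemma mean_deviation b x (eps p dmin dmax : R) : n * p = (count_of b x)%:R ->
  symmetric e -> 0 < eps <= 1 -> second_eigenvalue R e < 1 ->
  second_eigenvalue R e <= eps ->
  0 < dmin -> dmax <= (1 + eps) * dmin ->
  (forall v, dmin <= (degree e v)%:R <= dmax) ->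
  \sum_v `|neighbor_mean e (has_op R b x) v - p| <= 3 * eps * n.
Proof.
move=> pE e_sym /andP[eps0 eps1] l1 leps dmin0 dd dv.
have [V0|V0] := posnP #|V|.
  rewrite /n V0 mulr0 big1 // => v _.
  by have := card0_eq V0 v; rewrite inE.
have n0 : 0 < n by rewrite ltr0n.
pose d v : R := (degree e v)%:R; pose h v := has_op R b x v.
pose q v := neighbor_mean e (has_op R b x) v.
have h01 v : 0 <= h v <= 1 by rewrite /h /has_op; case: (x v == b); rewrite /= !ler01 ?lexx.
have p0 : 0 <= p by rewrite -(pmulr_rge0 _ n0) pE ler0n.
have p1 : p <= 1 by rewrite -(ler_pM2l n0) pE mulr1 count_of_le.
have nE c : n * c = \sum_(v : V) c by rewrite sumr_const /n mulr_natl.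
have sumh : \sum_v h v = n * p by rewrite sum_has_op.
have dlo v : dmin <= d v by case/andP: (dv v).
have dhi v : d v <= dmax by case/andP: (dv v).
have sumd_lo : n * dmin <= \sum_v d v by rewrite nE ler_sum.
have sumd_hi : \sum_v d v <= n * dmax by rewrite nE ler_sum.
have sumd0 : 0 < \sum_v d v by apply: lt_le_trans sumd_lo; rewrite mulr_gt0.
pose m := (\sum_v d v * h v) / \sum_v d v.
have mE : m * \sum_v d v = \sum_v d v * h v by rewrite divfK // gt_eqF.
have sumdh_hi : \sum_v d v * h v <= dmax * (n * p).
  by rewrite -sumh mulr_sumr; apply: ler_sum => v _; rewrite ler_wpM2r ?ler0n.
have sumdh_lo : dmin * (n * p) <= \sum_v d v * h v.
  by rewrite -sumh mulr_sumr; apply: ler_sum => v _; rewrite ler_wpM2r ?ler0n.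
have m0 : 0 <= m.
  rewrite divr_ge0 ?(ltW sumd0) // sumr_ge0 // => v _.
  by rewrite mulr_ge0 ?ler0n //; case/andP: (h01 v).
have m1 : m <= 1.
  rewrite ler_pdivrMr // mul1r; apply: ler_sum => v _.
  by rewrite ler_piMr ?ler0n //; case/andP: (h01 v).
have nd0 : 0 < n * dmin by rewrite mulr_gt0.
have mp_hi : m - p <= eps.
  have : m * (n * dmin) <= (1 + eps) * p * (n * dmin).
    apply: le_trans (ler_wpM2l m0 sumd_lo) _; rewrite mE.
    apply: le_trans sumdh_hi _.
    have := ler_wpM2r (mulr_ge0 (ltW n0) p0) dd.
    by rewrite (_ : (1 + eps) * p * _ = (1 + eps) * dmin * (n * p)) //; ring.
  by rewrite ler_pM2r //; nra.
have mp_lo : p - m <= eps.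
  have : p * (n * dmin) <= (1 + eps) * m * (n * dmin).
    rewrite (_ : p * _ = dmin * (n * p)); last by ring.
    apply: le_trans sumdh_lo _; rewrite -mE.
    apply: le_trans (ler_wpM2l m0 sumd_hi) _.
    have := ler_wpM2r (mulr_ge0 (ltW n0) m0) dd.
    rewrite (_ : (1 + eps) * m * _ = (1 + eps) * dmin * (n * m)); last by ring.
    by rewrite (_ : m * _ = dmax * (n * m)) //; ring.
  by rewrite ler_pM2r //; nra.
have var : \sum_v (q v - m) ^+ 2 <= 2 * eps ^+ 2 * n.
  have l0 := second_eigenvalue_ge0 R e.
  rewrite -(ler_pM2l dmin0) mulr_sumr.
  apply: (@le_trans _ _ (\sum_v d v * (q v - m) ^+ 2)).
    by apply: ler_sum => v _; rewrite ler_wpM2r ?sqr_ge0.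
  apply: le_trans (neighbor_variance e_sym deg_gt0 l1 (erefl m)) _.
  (* Both [f v] and m lie in [0, 1], so each squared deviation is at most 1; the factor 2 then
     bounds dmax / dmin <= 1 + eps. *)
  apply: (@le_trans _ _ (eps ^+ 2 * (n * dmax))).
    apply: ler_pM; rewrite ?sqr_ge0 ?lerXn2r ?nnegrE ?(ltW eps0) //.
      by apply: sumr_ge0 => v _; rewrite mulr_ge0 ?ler0n ?sqr_ge0.
    apply: le_trans sumd_hi; apply: ler_sum => v _.
    rewrite ler_piMr ?ler0n //.
    by have := h01 v; rewrite /h; move: (has_op R b x v) => c; nra.
  rewrite (_ : dmin * _ = eps ^+ 2 * (n * (2 * dmin))); last by ring.
  rewrite ler_wpM2l ?sqr_ge0 // ler_wpM2l ?(ltW n0) //.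
  by apply: le_trans dd _; rewrite ler_wpM2r ?(ltW dmin0) //; lra.
(* |q - m| <= eps / 2 + (q - m)^2 / (2 eps) by AM-GM, and |m - p| <= eps *)
apply: (@le_trans _ _ (\sum_v (eps / 2 + (2 * eps)^-1 * (q v - m) ^+ 2 + eps))).
  apply: ler_sum => v _; apply: (le_trans (ler_distD m _ _)).
  apply: lerD; last by rewrite ler_norml; apply/andP; split; lra.
  rewrite -/(q v) -(real_normK (num_real (q v - m))).
  move: `|q v - m| => t; rewrite -subr_ge0.
  rewrite (_ : _ - t = (2 * eps)^-1 * (t - eps) ^+ 2).
    by rewrite mulr_ge0 ?sqr_ge0 // invr_ge0; lra.
  by field; rewrite gt_eqF.
(* The three terms contribute eps / 2, eps and eps per node, together less than 3 eps. *)
rewrite !big_split /= -!nE -mulr_sumr.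
have : (2 * eps)^-1 * \sum_v (q v - m) ^+ 2 <= eps * n.
  rewrite (_ : eps * n = (2 * eps)^-1 * (2 * eps ^+ 2 * n)).
    by rewrite ler_wpM2l // invr_ge0; lra.
  by field; rewrite gt_eqF.
by nra.
Qed.

End DriftEstimate.

(** * The chain on a time grid *)

Fixpoint words (T : finType) (L : nat) : seq (seq T) :=
  if L is L'.+1 then [seq a :: c | a <- enum T, c <- words T L'] else [:: [::]].

Lemma mem_words (T : finType) L c : (c \in words T L) = (size c == L).
Proof.
elim: L c => [|L IH] [|a c] //=.
- by apply/allpairsP => -[[b c]] [].
- rewrite eqSS -IH; apply/allpairsP/idP => [[[b c'] [_ /= c'L [_ ->]]] //|cL].
  by exists (a, c); rewrite mem_enum.
Qed.

Lemma words_uniq (T : finType) L : uniq (words T L).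
Proof.
elim: L => [|L IH] //=; apply: allpairs_uniq; rewrite ?enum_uniq //.
by move=> [a c] [b c'] _ _ /= [-> ->].
Qed.

Lemma sum_words (R : nmodType) (T : finType) L (F : seq T -> R) :
  \sum_(c <- words T L.+1) F c = \sum_a \sum_(c <- words T L) F (a :: c).
Proof. by rewrite /= big_allpairs_dep big_enum. Qed.

(* What happens during a time cell that contains at most one update: either
   nothing, or the update of a node with its draw. *)
Notation cell_move V := (option (V * draw V)).

Definition step (V : finType) (a : cell_move V) (x : state V) : state V :=
  if a is Some (v, m) then update v m x else x.

Fixpoint visits (V : finType) (S : pred (state V)) (x : state V)
    (c : seq (cell_move V)) : bool :=
  S x || (if c is a :: c' then visits S (step a x) c' else false).

(** The probability of this move in a cell of length h: each silent clock contributes exp(-h), the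
    clock that rings once contributes h exp(-h). The weights add up to less than 1 when n h > 0; the
    missing mass belongs to cells with several updates. *)
Definition move_weight (R : realType) (V : finType) (e : rel V) (alpha h : R)
    (a : cell_move V) : R :=
  expR (- (#|V|%:R * h)) *
  (if a is Some (v, m) then h * draw_pmf e alpha v m else 1).

Definition word_weight (R : realType) (V : finType) (e : rel V) (alpha h : R)
    (c : seq (cell_move V)) : R :=
  \prod_(a <- c) move_weight e alpha h a.

Section Words.
Variables (R : realType) (V : finType) (e : rel V) (alpha h : R).
Hypotheses (alpha01 : 0 <= alpha <= 1) (deg_gt0 : forall v, (0 < degree e v)%N).
Hypothesis h0 : 0 <= h.
Implicit Types (x : state V) (S : pred (state V)) (L : nat) (f : state V -> R).

Let n : R := #|V|%:R.
Let w := word_weight e alpha h.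
Let w1 := move_weight e alpha h.

Lemma move_weight_ge0 a : 0 <= move_weight e alpha h a.
Proof.
by case: a => [[v m]|]; rewrite mulr_ge0 ?expR_ge0 // mulr_ge0 // draw_pmf_ge0.
Qed.

Lemma word_weight_ge0 c : 0 <= word_weight e alpha h c.
Proof. by apply: prodr_ge0 => a _; apply: move_weight_ge0. Qed.

Lemma word_weight_cons a c :
  word_weight e alpha h (a :: c) = w1 a * word_weight e alpha h c.
Proof. by rewrite /word_weight big_cons. Qed.

Lemma sum_move (F : cell_move V -> R) :
  \sum_a F a = F None + \sum_v \sum_m F (Some (v, m)).
Proof.
rewrite (bigD1 None) //=; congr (_ + _); rewrite pair_bigA /=.
rewrite (reindex_omap Some id) //=; last by case.
by apply: eq_big => [p|[v m] _] //; rewrite eqxx.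
Qed.

(** With generator G, the semigroup is exp(h G) = exp(- n h) exp(h (n + G)); one cell with at most
    one update is its truncation exp(- n h) (1 + h (n + G)). *)
Lemma sum_move_weight f x :
  \sum_a w1 a * f (step a x) =
  expR (- (n * h)) * ((1 + n * h) * f x + h * generator e alpha f x).
Proof.
rewrite sum_move /w1 /move_weight -/n /= mulr1 /generator.
under [X in _ + X]eq_bigr do under eq_bigr do rewrite -!mulrA.
under [X in _ + X]eq_bigr do rewrite -!mulr_sumr.
rewrite -!mulr_sumr -mulrDr; congr (_ * _).
rewrite mulrDl mul1r -addrA; congr (_ + _).
under [X in _ = _ + _ * X]eq_bigr do under eq_bigr do rewrite mulrBr.
under [X in _ = _ + _ * X]eq_bigr do rewrite sumrB -mulr_suml draw_pmf_sum1 // mul1r.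
rewrite sumrB sumr_const -[#|_|]/#|V|.
by rewrite -[f x *+ _]mulr_natl -/n; ring.
Qed.

Lemma sum_words_total L :
  \sum_(c <- words _ L) w c = (expR (- (n * h)) * (1 + n * h)) ^+ L.
Proof.
elim: L => [|L IH]; first by rewrite big_seq1 /w /word_weight big_nil.
rewrite sum_words /w.
under eq_bigr do under eq_bigr do rewrite word_weight_cons.
under eq_bigr do rewrite -mulr_sumr IH.
rewrite -mulr_suml exprS; congr (_ * _).
(* Any configuration would do: the identity is used for the constant function 1. *)
pose x0 : state V := [ffun=> true].
have := sum_move_weight (fun=> 1) x0.
under eq_bigr do rewrite mulr1.
move=> ->; rewrite /generator mulr1 !big1 ?mulr0 ?addr0 // => v _.
by rewrite big1 // => m _; rewrite subrr mulr0.
Qed.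

Let nh0 : 0 <= n * h. Proof. by rewrite mulr_ge0 ?ler0n. Qed.

Let base_le1 : expR (- (n * h)) * (1 + n * h) <= 1.
Proof.
by rewrite expRN mulrC ler_pdivrMr ?expR_gt0 // mul1r expR_ge1Dx.
Qed.

Let base_ge0 : 0 <= expR (- (n * h)) * (1 + n * h).
Proof. by rewrite mulr_ge0 ?expR_ge0 // addr_ge0. Qed.

Lemma sum_words_le1 L : \sum_(c <- words _ L) w c <= 1.
Proof. by rewrite sum_words_total exprn_ile1. Qed.

(** exp(- y) (1 + y) >= (1 - y) (1 + y) = 1 - y^2, and the power follows by Bernoulli's
    inequality. *)
Lemma sum_words_ge L : 1 - L%:R * (n * h) ^+ 2 <= \sum_(c <- words _ L) w c.
Proof.
rewrite sum_words_total; set t := expR _ * _.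
have t1 : 1 - (n * h) ^+ 2 <= t.
  rewrite (_ : 1 - _ = (1 - n * h) * (1 + n * h)); last by ring.
  by rewrite ler_wpM2r ?addr_ge0 // expR_ge1Dx.
elim: L => [|L IH]; first by rewrite mul0r subr0 expr0.
have tL : t ^+ L <= 1 by rewrite exprn_ile1.
have tL0 : 0 <= t ^+ L by rewrite exprn_ge0.
have tt : 0 <= (1 - t) * (1 - t ^+ L) by rewrite mulr_ge0 // subr_ge0.
rewrite [t ^+ _]exprS -natr1; move: (t ^+ L) ((n * h) ^+ 2) tt IH t1 => u z; lra.
Qed.

(** A maximal inequality for f stopped on S: off S its mean grows by at most h kappa per cell, and
    at the first visit f is at least f0. Splitting off the first move yields the induction. *)
Lemma sum_words_visits S f (f0 kappa : R) L x :
  (forall y, 0 <= f y) -> 0 <= kappa -> 0 <= f0 -> (forall y, S y -> f0 <= f y) ->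
  (forall y, ~~ S y -> generator e alpha f y <= kappa) ->
  f0 * \sum_(c <- words _ L | visits S x c) w c <= f x + L%:R * h * kappa.
Proof.
move=> fge0 k0 f00 fS fk; elim: L x => [|L IH] x.
  rewrite mul0r mul0r addr0 [X in X <= _](_ : _ = if S x then f0 else 0).
    by case: ifP => [/fS|].
  rewrite big_mkcond big_seq1 /= orbF /w /word_weight big_nil.
  by case: ifP; rewrite ?mulr1 ?mulr0.
have [Sx|nSx] := boolP (S x).
  apply: le_trans (le_trans (fS _ Sx) _); last first.
    by rewrite lerDl !mulr_ge0 ?ler0n.
  rewrite ler_piMr //; apply: le_trans (sum_words_le1 L.+1).
  rewrite big_mkcond /=; apply: ler_sum => c _.
  by case: ifP => // _; apply: word_weight_ge0.
rewrite big_mkcond sum_words.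
rewrite (eq_bigr (fun a => w1 a * \sum_(c <- words _ L | visits S (step a x) c) w c)).
  rewrite mulr_sumr.
  apply: (@le_trans _ _ (\sum_a w1 a * (f (step a x) + L%:R * h * kappa))).
    apply: ler_sum => a _; rewrite mulrCA ler_wpM2l ?move_weight_ge0 //.
  rewrite (sum_move_weight (fun y => f y + L%:R * h * kappa)).
  have -> : generator e alpha (fun y => f y + L%:R * h * kappa) x = generator e alpha f x.
    by apply: eq_bigr => v _; apply: eq_bigr => m _; congr (_ * _); ring.
  have gk := fk _ nSx; have fx := fge0 x.
  have Lk : 0 <= L%:R * h * kappa by rewrite !mulr_ge0 ?ler0n.
  apply: (@le_trans _ _ (expR (- (n * h)) * ((1 + n * h) * (f x + L%:R * h * kappa) + h * kappa))).
    by rewrite ler_wpM2l ?expR_ge0 // lerD2l ler_wpM2l.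
  have e1 : expR (- (n * h)) <= 1 by rewrite expR_le1 oppr_le0.
  rewrite mulrDr mulrA -natr1 !mulrDl mul1r addrA; apply: lerD.
    by rewrite ler_piMl // addr_ge0.
  by rewrite ler_piMl // mulr_ge0.
move=> a _; rewrite mulr_sumr [RHS]big_mkcond; apply: eq_bigr => c _ /=.
by rewrite (negPf nSx) /= /w word_weight_cons.
Qed.

(** While S is avoided, f is at least 1 but its mean shrinks by exp(- r h) per cell. *)
Lemma sum_words_avoid S f (r : R) L x :
  (forall y, 0 <= f y) -> (forall y, ~~ S y -> 1 <= f y) ->
  (forall y, ~~ S y -> generator e alpha f y <= - r * f y) ->
  \sum_(c <- words _ L | ~~ visits S x c) w c <= expR (- (r * (L%:R * h))) * f x.
Proof.
move=> fge0 f1 fr; elim: L x => [|L IH] x.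
  rewrite mul0r mulr0 oppr0 expR0 mul1r.
  rewrite big_mkcond big_seq1 /= orbF /w /word_weight big_nil.
  by case: ifP => // /f1.
have [Sx|nSx] := boolP (S x).
  rewrite big_mkcond sum_words big1 ?mulr_ge0 ?expR_ge0 // => a _.
  by rewrite big1 // => c _ /=; rewrite Sx.
rewrite big_mkcond sum_words.
rewrite (eq_bigr (fun a => w1 a * \sum_(c <- words _ L | ~~ visits S (step a x) c) w c)).
  apply: (@le_trans _ _ (\sum_a w1 a * (expR (- (r * (L%:R * h))) * f (step a x)))).
    by apply: ler_sum => a _; rewrite ler_wpM2l ?move_weight_ge0.
  under eq_bigr do rewrite mulrCA.
  rewrite -mulr_sumr sum_move_weight -natr1.
  rewrite [- (r * ((L%:R + 1) * h))](_ : _ = - (r * (L%:R * h)) + - (r * h)); last by ring.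
  rewrite expRD -mulrA ler_wpM2l ?expR_ge0 //.
  (* exp(- n h) (1 + n h - r h) <= exp(- r h), so the clock factor cancels exactly. *)
  rewrite [- (r * h)](_ : _ = - (n * h) + (n * h - r * h)); last by ring.
  rewrite expRD -mulrA ler_wpM2l ?expR_ge0 //.
  apply: (@le_trans _ _ ((1 + (n * h - r * h)) * f x)).
    have := ler_wpM2l h0 (fr _ nSx).
    move: (generator _ _ _ _) => gx; move: (f x) => fx; nra.
  by rewrite ler_wpM2r // expR_ge1Dx.
move=> a _; rewrite mulr_sumr [RHS]big_mkcond; apply: eq_bigr => c _ /=.
by rewrite (negPf nSx) /= /w word_weight_cons.
Qed.

End Words.

(** * Paths between grid times *)

Lemma near_rightP (R : realType) (t : R) (Q : R -> Prop) :
  (\forall s \near t^'+, Q s) ->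
  exists2 r : R, 0 < r & forall s, t < s < t + r -> Q s.
Proof.
case=> r /= r0 H; exists r => // s /andP[ts str]; apply: H => //=.
by rewrite ltr0_norm ?subr_lt0 // opprB ltrBlDl.
Qed.

Lemma near_leftP (R : realType) (t : R) (Q : R -> Prop) :
  (\forall s \near t^'-, Q s) ->
  exists2 r : R, 0 < r & forall s, t - r < s < t -> Q s.
Proof.
case=> r /= r0 H; exists r => // s /andP[ts str]; apply: H => //=.
by rewrite gtr0_norm ?subr_gt0 // ltrBlDr -ltrBlDl.
Qed.

Section Path.
Variables (R : realType) (V : finType).
Variables (N : V -> R -> nat) (M : V -> nat -> draw V) (X : R -> state V).
Hypothesis N_mono : forall v s t, 0 <= s <= t -> (N v s <= N v t)%N.
Hypothesis N_rcont : forall v t, 0 <= t -> \forall s \near t^'+, N v s = N v t.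
Hypothesis X_evolves : evolves_by N M X.

Lemma constant_opinion v a b : 0 <= a <= b -> N v a = N v b -> X b v = X a v.
Proof.
move=> /andP[a0 ab] Nab; have [->//|ab'] := eqVneq a b.
have b0 : 0 < b by apply: le_lt_trans a0 _; rewrite lt_neqAle ab'.
by apply: (X_evolves v b0).1 => //; rewrite a0.
Qed.

(** The jump time is the infimum of the times at which the count has reached its final value.
    Right-continuity makes the infimum attained, so the count there exceeds all earlier ones, as
    [evolves_by] demands. *)
Lemma first_jump v a b : 0 <= a < b -> N v b = (N v a).+1 ->
  exists s, [/\ a < s <= b, N v s = N v b & forall r, 0 <= r < s -> (N v r < N v s)%N].
Proof.
move=> /andP[a0 ab] Nb.
pose E : set R := [set s | a <= s <= b /\ N v s = N v b].
have Eb : E b by split; rewrite // lexx ltW.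
have E_lb : lbound E a by move=> s [] /andP[].
have hE : has_inf E by split; [exists b|exists a].
pose s := inf E.
have as_ : a <= s by apply: lb_le_inf => //; exists b.
have sb : s <= b by apply: ge_inf => //; exists a.
have s0 : 0 <= s := le_trans a0 as_.
have Ns : N v s = N v b.
  have [r r0 Hr] := near_rightP (N_rcont v s0).
  have [y [/andP[ay yb] Ny] ysr] : exists2 y, E y & y < s + r.
    exact: inf_adherent.
  have sy : s <= y by apply: ge_inf; [exists a|split=> //; rewrite ay].
  move: sy; rewrite le_eqVlt => /predU1P[->//|sy].
  by rewrite -Ny -(Hr y) // sy.
have as' : a < s.
  by rewrite lt_neqAle as_ andbT; apply/eqP => e; move: Nb; rewrite -Ns -e => /n_Sn.
exists s; split=> //; first by rewrite as'.
move=> r /andP[r0 rs]; rewrite ltn_neqAle N_mono ?r0 ?ltW // andbT.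
apply/eqP => Nr; have [ra|ar] := ltP r a.
  have : (N v r <= N v a)%N by rewrite N_mono // r0 ltW.
  by rewrite Nr Ns Nb ltnn.
have : E r by split; [rewrite ar (le_trans (ltW rs))|rewrite Nr Ns].
by move/(ge_inf (ex_intro _ a E_lb)); rewrite leNgt rs.
Qed.

(** The second conclusion, that only the two end configurations occur inside the cell, lets visits
    at arbitrary times be detected on the grid. *)
Lemma one_jump v a b : 0 <= a < b -> N v b = (N v a).+1 ->
  (forall u, u != v -> N u b = N u a) ->
  X b = update v (M v (N v b)) (X a) /\
  forall s, a <= s <= b -> X s = X a \/ X s = X b.
Proof.
move=> /andP[a0 ab] Nb Nu.
have Xu s u : a <= s <= b -> u != v -> X s u = X a u.
  move=> /andP[as_ sb] uv; apply: constant_opinion; first by rewrite a0.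
  apply/eqP; rewrite eqn_leq N_mono ?a0 //= -(Nu u uv) N_mono // sb.
  by rewrite (le_trans a0).
have Xs s : a <= s <= b -> N v s = N v a -> X s = X a.
  move=> sab Ns; apply/ffunP => u; have [->|uv] := eqVneq u v; last exact: Xu.
  by apply: constant_opinion => //; rewrite a0; case/andP: sab.
have Xs' s : a <= s <= b -> N v s = N v b -> X s = X b.
  move=> sab Ns; apply/ffunP => u; have [->|uv] := eqVneq u v.
    apply/esym/constant_opinion => //; case/andP: sab => as_ ->.
    by rewrite (le_trans a0).
  by rewrite !Xu // lexx ltW.
split; last first.
  move=> s sab; have /andP[as_ sb] := sab.
  have : (N v a <= N v s)%N by rewrite N_mono // a0.
  have : (N v s <= N v b)%N by rewrite N_mono // sb (le_trans a0).
  rewrite Nb leq_eqVlt => /predU1P[Ns _|]; first by right; apply: Xs'; rewrite ?Nb.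
  rewrite ltnS => Ns1 Ns2; left; apply: Xs => //.
  by apply/eqP; rewrite eqn_leq Ns1.
have a0b : 0 <= a < b by rewrite a0.
have [s [/andP[as_ sb] Ns sjump]] := first_jump a0b Nb.
apply/ffunP => u; rewrite ffunE; case: eqVneq => [->|uv]; last first.
  by apply: Xu; rewrite // lexx ltW.
have s0 : 0 < s := le_lt_trans a0 as_.
have [r r0 Hr] := near_leftP ((X_evolves v s0).2 sjump).
(* A time y in (a, s) close enough to s for the update rule; v has not jumped by then, so the
   configuration at y is still that at a. *)
pose y := Num.max ((a + s) / 2) (s - r / 2).
have ys : y < s by rewrite gt_max; apply/andP; split; lra.
have ay : a < y by rewrite lt_max; apply/orP; left; lra.
have ry : s - r < y by rewrite lt_max; apply/orP; right; lra.
have yab : a <= y <= b by rewrite (ltW ay) (ltW (lt_le_trans ys sb)).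
have Ny : N v y = N v a.
  have := sjump y; rewrite ys (ltW (le_lt_trans a0 ay)) Ns Nb ltnS => /(_ isT) H.
  by apply/eqP; rewrite eqn_leq H N_mono // a0 ltW.
rewrite -(Xs' s) ?(ltW as_) ?sb // (Hr y) ?ry // Ns (Xs y) //.
Qed.

End Path.

Definition jumps (V : finType) (a : cell_move V) (v : V) : nat :=
  if a is Some (u, _) then (u == v)%N else 0%N.

Definition draw_at (V : finType) (v : V) (a : cell_move V) : option (draw V) :=
  if a is Some (u, m) then (if u == v then Some m else None) else None.

Definition draws_of (V : finType) (c : seq (cell_move V)) (v : V) : seq (draw V) :=
  pmap (draw_at v) c.

Definition run (V : finType) (x : state V) (c : seq (cell_move V)) : state V :=
  foldl (fun y a => step a y) x c.

Lemma draws_of_rcons (V : finType) (c : seq (cell_move V)) a v :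
  draws_of (rcons c a) v = draws_of c v ++ (if draw_at v a is Some m then [:: m] else [::]).
Proof. by rewrite /draws_of -cats1 pmap_cat /=; case: draw_at. Qed.

Lemma run_rcons (V : finType) (x : state V) c a : run x (rcons c a) = step a (run x c).
Proof. by rewrite /run -cats1 foldl_cat. Qed.

Lemma visitsP (V : finType) (S : pred (state V)) x c :
  reflect (exists2 j, (j <= size c)%N & S (run x (take j c))) (visits S x c).
Proof.
apply: (iffP idP).
  elim: c x => [|a c IH] x /=; first by rewrite orbF => Sx; exists 0%N.
  case/orP => [Sx|/IH[j jc Sj]]; first by exists 0%N.
  by exists j.+1.
case; elim: c x => [|a c IH] x [|j] //=; rewrite ?take0 ?orbF //.
- by move=> _ ->.
- by move=> /IH H /H ->; rewrite orbT.
Qed.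

Section Follow.
Variables (R : realType) (V : finType) (h : R).
Hypothesis h0 : 0 < h.
Variables (N : V -> R -> nat) (M : V -> nat -> draw V).
Hypothesis N0 : forall v, N v 0 = 0%N.
Hypothesis N_mono : forall v s t, 0 <= s <= t -> (N v s <= N v t)%N.

Let t (i : nat) : R := i%:R * h.

Let t_step i : 0 <= t i < t i.+1.
Proof. by rewrite /t mulr_ge0 ?ler0n ?(ltW h0) //= ltr_pM2r // ltr_nat. Qed.

(** Only finitely many increments and draws are prescribed, so independence yields the probability.
    Draws are numbered from 1, whence [j.+1]. *)
Definition follows (c : seq (cell_move V)) : Prop :=
  (forall v i, (i < size c)%N ->
     (N v (i.+1%:R * h) - N v (i%:R * h))%N = jumps (nth None c i) v) /\
  (forall v j, (j < size (draws_of c v))%N ->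
     M v j.+1 = nth (inr true) (draws_of c v) j).

Lemma follows_step c v i : follows c -> (i < size c)%N ->
  N v (t i.+1) = (N v (t i) + jumps (nth None c i) v)%N.
Proof.
move=> [Hc _] ic; rewrite -Hc // subnKC // N_mono //.
by have /andP[-> /ltW ->] := t_step i.
Qed.

Lemma follows_count c v i : follows c -> (i <= size c)%N ->
  N v (t i) = size (draws_of (take i c) v).
Proof.
move=> Hc; elim: i => [|i IH] ic; first by rewrite /t mul0r N0 take0.
rewrite (follows_step _ Hc) // IH; last exact: ltnW.
rewrite (take_nth None) // draws_of_rcons size_cat; congr (_ + _)%N.
by case: (nth None c i) => [[u m]|] //=; case: eqP.
Qed.

Lemma follows_draw c v m i : follows c -> (i < size c)%N ->
  nth None c i = Some (v, m) -> M v (N v (t i.+1)) = m.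
Proof.
move=> Hc ic ci; rewrite (follows_step _ Hc) // ci /= eqxx addn1.
rewrite (follows_count v Hc (ltnW ic)).
have E : draws_of c v = draws_of (take i c) v ++ m :: draws_of (drop i.+1 c) v.
  rewrite -[in LHS](cat_take_drop i c) (drop_nth None) // ci.
  by rewrite /draws_of pmap_cat /= eqxx.
rewrite (Hc.2 v); first by rewrite E nth_cat ltnn subnn.
by rewrite E size_cat /= addnS ltnS leq_addr.
Qed.

(** Increments reveal who updates in each cell, and the running counts then identify the draw.
    Distinct words of equal length thus have disjoint events. *)
Lemma follows_inj c c' : follows c -> follows c' -> size c = size c' -> c = c'.
Proof.
move=> Hc Hc' cc'; apply: (@eq_from_nth _ None) => // i ic.
have ic' : (i < size c')%N by rewrite -cc'.
have J v : jumps (nth None c i) v = jumps (nth None c' i) v.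
  by rewrite -(Hc.1 v) // -(Hc'.1 v).
case E : (nth None c i) => [[u m]|]; case E' : (nth None c' i) => [[u' m']|] //.
- have uu' : u' = u.
    by have := J u; rewrite E E' /= eqxx; case: eqP.
  by rewrite uu' in E' *; rewrite -(follows_draw Hc ic E) -(follows_draw Hc' ic' E').
- by have := J u; rewrite E E' /= eqxx.
- by have := J u'; rewrite E E' /= eqxx.
Qed.

Variable X : R -> state V.
Hypothesis N_rcont : forall v t, 0 <= t -> \forall s \near t^'+, N v s = N v t.
Hypothesis X_evolves : evolves_by N M X.

Lemma follows_cell c i : follows c -> (i < size c)%N ->
  X (t i.+1) = step (nth None c i) (X (t i)) /\
  forall s, t i <= s <= t i.+1 -> X s = X (t i) \/ X s = X (t i.+1).
Proof.
move=> Hc ic; have tt := t_step i; have /andP[ti0 tii] := tt.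
have St v := follows_step v Hc ic.
case E : (nth None c i) => [[u m]|]; rewrite E in St.
  have Nu : N u (t i.+1) = (N u (t i)).+1 by rewrite St /= eqxx addn1.
  have No v : v != u -> N v (t i.+1) = N v (t i).
    by rewrite St /= eq_sym => /negPf ->; rewrite addn0.
  have [H1 H2] := one_jump N_mono N_rcont X_evolves tt Nu No.
  by split=> //; rewrite H1 (follows_draw Hc ic E).
have Xc s : t i <= s <= t i.+1 -> X s = X (t i).
  move=> /andP[ts st]; apply/ffunP => v.
  apply: (constant_opinion X_evolves); first by rewrite ti0.
  apply/eqP; rewrite eqn_leq N_mono ?ti0 //=.
  by move: (St v); rewrite addn0 => <-; rewrite N_mono // st (le_trans ti0).
by split=> [|s /Xc ->]; [rewrite Xc // lexx ltW|left].
Qed.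

Lemma follows_run c x i : X 0 = x -> follows c -> (i <= size c)%N ->
  X (t i) = run x (take i c) /\
  forall s, 0 <= s <= t i -> exists2 j, (j <= i)%N & X s = run x (take j c).
Proof.
move=> Xx Hc; elim: i => [|i IH] ic.
  rewrite /t mul0r take0; split=> // s; rewrite -eq_le => /eqP <-.
  by exists 0%N; rewrite // take0.
have [Xi Hi] := IH (ltnW ic); have [Xi1 Hi1] := follows_cell Hc ic.
have Xi1' : X (t i.+1) = run x (take i.+1 c).
  by rewrite Xi1 (take_nth None) // run_rcons Xi.
split=> // s /andP[s0 st]; have [si|si] := leP s (t i).
  by have [|j ji Xj] := Hi s; [rewrite s0|exists j => //; apply: leqW].
have [|->|->] := Hi1 s; first by rewrite (ltW si).
- by exists i.
- by exists i.+1.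
Qed.

End Follow.

(** * Probability of a prescribed sequence of updates on a time grid *)

Lemma sum_measure_disjoint_le1 (R : realType) (d : measure_display)
    (Omega : measurableType d) (P : probability Omega R) (I : eqType)
    (F : I -> set Omega) (s : seq I) (B : set Omega) :
  uniq s -> measurable B -> (forall i, measurable (F i)) ->
  (forall i j w, i \in s -> j \in s -> F i w -> F j w -> i = j) ->
  (forall i w, i \in s -> F i w -> ~ B w) ->
  (\sum_(i <- s) P (F i) + P B <= 1)%E.
Proof.
move=> + + mF; elim: s B => [|i s IH] B.
  by move=> _ mB _ _; rewrite big_nil add0e probability_le1.
move=> /= /andP[si us] mB Fdis FB; rewrite big_cons.
rewrite addeAC [(P (F i) + _)%E]addeC addeC.
have <- : P (B `|` F i) = (P B + P (F i))%E.
  rewrite measureU //; apply/seteqP; split=> // w [Bw Fw].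
  by apply: (FB i w) => //; rewrite mem_head.
apply: IH => //; first exact: measurableU.
  by move=> a b w As bs; apply: Fdis; rewrite inE ?As ?bs orbT.
move=> j w js Fj [Bw|Fi]; first by apply: (FB j w) => //; rewrite inE js orbT.
have ij : i = j by apply: (Fdis i j w); rewrite ?mem_head // inE js orbT.
by rewrite ij js in si.
Qed.

Section WordEvents.
Variables (R : realType) (V : finType) (e : rel V) (alpha : R).
Variables (d : measure_display) (Omega : measurableType d).
Variables (P : probability Omega R).
Variables (N : V -> R -> Omega -> nat) (M : V -> nat -> Omega -> draw V).
Hypothesis noise : driving_noise e alpha P N M.
Variable h : R.
Hypothesis h0 : 0 < h.
Implicit Type c : seq (cell_move V).

Let n : R := #|V|%:R.
Let t (i : nat) : R := i%:R * h.

Definition word_event c : set Omega :=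
  [set w | follows h (fun v t => N v t w) (fun v i => M v i w) c].

(** The independent sources constrained by c: every clock in every cell, and the draws that c
    consumes. *)
Let index c : seq ((V * nat) + (V * nat)) :=
  [seq inl (v, i) | v <- enum V, i <- iota 0 (size c)] ++
  [seq inr (v, j.+1) | v <- enum V, j <- iota 0 (size (draws_of c v))].

Let requirement c (a : (V * nat) + (V * nat)) : set Omega :=
  match a with
  | inl (v, i) => increment (N v) (t i) (t i.+1) @^-1` [set jumps (nth None c i) v]
  | inr (v, j) => M v j @^-1` [set nth (inr true) (draws_of c v) j.-1]
  end.

Let word_eventE c : word_event c = \big[setI/setT]_(a <- index c) requirement c a.
Proof.
rewrite -bigcap_seq; apply/seteqP; split=> w /=.
  move=> [Hi Hm] [[v i]|[v j]]; rewrite /= mem_cat => /orP[] /allpairsPdep[u [k []]].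
  - by rewrite mem_iota add0n => _ /= ki [-> ->]; apply: Hi.
  - by [].
  - by [].
  - by rewrite mem_iota add0n => _ /= ki [-> ->] /=; apply: Hm.
move=> H; split=> v i ic.
  apply: (H (inl (v, i))); rewrite /= mem_cat; apply/orP; left.
  by apply/allpairsPdep; exists v, i; rewrite mem_enum mem_iota.
apply: (H (inr (v, i.+1))); rewrite /= mem_cat; apply/orP; right.
by apply/allpairsPdep; exists v, i; rewrite mem_enum mem_iota.
Qed.

Let index_uniq c : uniq (index c).
Proof.
rewrite cat_uniq; apply/and3P; split.
- apply: allpairs_uniq_dep => [|v _|]; [exact: enum_uniq|exact: iota_uniq|].
  by move=> [v i] [u j] _ _ /= [-> ->].
- apply/hasPn => a /allpairsPdep[v [j [_ _ ->]]].
  by apply/negP => /allpairsPdep[u [i [_ _]]].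
- apply: allpairs_uniq_dep => [|v _|]; [exact: enum_uniq|exact: iota_uniq|].
  by move=> [v i] [u j] _ _ /= [-> ->].
Qed.

Let t_ge0 i : 0 <= t i. Proof. by rewrite /t mulr_ge0 ?ler0n // ltW. Qed.

Let t_homo : {homo t : i j / (i <= j)%N >-> i <= j}.
Proof. by move=> i j ij; rewrite /t ler_wpM2r ?ler_nat // ltW. Qed.

Let increment_measurable v i k : measurable (increment (N v) (t i) (t i.+1) @^-1` [set k]).
Proof.
have [/(_ v)[_ _ _ Nm _] _ _ _] := noise.
have -> : increment (N v) (t i) (t i.+1) @^-1` [set k] =
    \bigcup_a \bigcup_(b in [set b | (b - a)%N = k])
       ((N v (t i) @^-1` [set a]) `&` (N v (t i.+1) @^-1` [set b])).
  apply/seteqP; split=> w.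
    by move=> /= <-; exists (N v (t i) w) => //; exists (N v (t i.+1) w).
  by move=> [a _ [b /= ab [/= Na Nb]]]; rewrite /increment Na Nb ab.
apply: bigcup_measurable => a _; apply: bigcup_measurable => b _.
by apply: measurableI; apply: Nm; apply: t_ge0.
Qed.

Lemma word_event_measurable c : measurable (word_event c).
Proof.
rewrite word_eventE; elim/big_ind: _ => // [|[[v i]|[v j]] _].
- exact: measurableI.
- exact: increment_measurable.
- by have [_ Mm _ _] := noise; exact: Mm.
Qed.

Let poisson_prod (a : cell_move V) :
  \prod_v poisson_pmf h (jumps a v) =
  expR (- (n * h)) * (if a is Some _ then h else 1).
Proof.
have E0 : poisson_pmf h 0 = expR (- h) by rewrite /poisson_pmf h0 expr0 fact0 invr1 !mul1r.
have E1 : poisson_pmf h 1 = h * expR (- h).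
  by rewrite /poisson_pmf h0 expr1 factS fact0 muln1 invr1 mulr1.
have En : expR (- (n * h)) = \prod_(v : V) expR (- h).
  by rewrite prodr_const -expRM_natl mulrN.
rewrite En; case: a => [[u m]|] /=; last first.
  by rewrite mulr1; apply: eq_bigr.
rewrite mulrC (bigD1 u) //= [in RHS](bigD1 u) //= eqxx E1 mulrA; congr (_ * _).
by apply: eq_bigr => v; rewrite eq_sym => /negPf ->.
Qed.

Let draws_prod c :
  \prod_v \prod_(m <- draws_of c v) draw_pmf e alpha v m =
  \prod_(a <- c) (if a is Some (v, m) then draw_pmf e alpha v m else 1).
Proof.
elim: c => [|a c IH]; first by rewrite big_nil big1 // => v _; rewrite big_nil.
rewrite big_cons -IH; case: a => [[u m]|]; last by rewrite mul1r.
rewrite [in LHS](bigD1 u) //= [in RHS](bigD1 u) //= eqxx big_cons -mulrA.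
congr (_ * (_ * _)); apply: eq_bigr => v; rewrite eq_sym => /negPf vu.
by rewrite /draws_of /= vu.
Qed.

(** Independence gives a product over nodes of Poisson masses and draw probabilities; exchanging the
    products regroups it cell by cell into [move_weight]. *)
Lemma word_event_prob c : P (word_event c) = (word_weight e alpha h c)%:E.
Proof.
have [Np Mm Mp /(_ t (t_ge0 0) t_homo) ind] := noise.
rewrite word_eventE (ind _ (requirement c)) //; last first.
  move=> [[v i]|[v j]] _ /=.
    by exists [set jumps (nth None c i) v].
  by exists [set nth (inr true) (draws_of c v) j.-1].
rewrite big_cat !big_allpairs_dep /=.
rewrite (eq_bigr (fun v => (\prod_(a <- c) poisson_pmf h (jumps a v))%:E)); last first.
  move=> v _; have [_ _ _ _ Npm] := Np v.
  rewrite (big_nth None) -prodEFin /index_iota subn0; apply: eq_bigr => i _.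
  rewrite Npm ?t_ge0 /=.
    by congr (poisson_pmf _ _)%:E; rewrite /t -natr1 mulrDl mul1r addrC addKr.
  by rewrite /t ltr_pM2r // ltr_nat.
rewrite (eq_bigr (F1 := fun v => \prod_(j <- iota 0 _) _)%E
  (fun v => (\prod_(m <- draws_of c v) draw_pmf e alpha v m)%:E)); last first.
  move=> v _; rewrite (big_nth (inr true)) -prodEFin /index_iota subn0.
  by apply: eq_bigr => j _; rewrite Mp.
rewrite !prodEFin -EFinM !big_enum /= draws_prod exchange_big /=.
rewrite (eq_bigr _ (fun a _ => poisson_prod a)) -big_split /=.
congr _%:E; apply: eq_bigr => a _; rewrite /move_weight -/n -mulrA.
by case: a => [[v m]|]; rewrite ?mulr1.
Qed.

End WordEvents.

(** * From words to probabilities of events of the dynamics *)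

Section TwoChoices.
Variables (R : realType) (V : finType) (e : rel V) (alpha : R).
Hypotheses (alpha01 : 0 <= alpha <= 1) (deg_gt0 : forall v, (0 < degree e v)%N).
Variables (d : measure_display) (Omega : measurableType d).
Variables (P : probability Omega R) (x : state V) (X : R -> Omega -> state V).
Hypothesis HX : two_choices e alpha P x X.

Let n : R := #|V|%:R.

Lemma state_measurable t (S : set (state V)) : 0 <= t ->
  measurable (X t @^-1` S).
Proof.
move=> t0; have [mX _ _] := HX.
have -> : X t @^-1` S = \bigcup_(y in S) (X t @^-1` [set y]).
  by apply/seteqP; split=> w /=; [move=> Sw; exists (X t w)|move=> [y Sy /= ->]].
apply: fin_bigcup_measurable => [|y _]; last exact: mX.
exact: finite_finset.
Qed.

(** The initial condition holds only almost surely, whereas following a word needs it pointwise. *)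
Lemma probability_on_start (B : set Omega) : measurable B ->
  P B = P (B `&` X 0 @^-1` [set x]).
Proof.
move=> mB; have [mX P1 _] := HX.
have mA := mX 0 x (lexx 0).
have PC : P (~` (X 0 @^-1` [set x])) = 0%E.
  by rewrite probability_setC // P1 subee.
apply/eqP; rewrite eq_le; apply/andP; split; last first.
  by apply: le_measure; [apply/mem_set; exact: measurableI|exact/mem_set|exact: subIsetl].
rewrite -[leRHS]adde0 -PC; apply: le_trans (measureU2 _ _ _).
- apply: le_measure; first exact/mem_set.
    by apply/mem_set/measurableU; [exact: measurableI|exact: measurableC].
  by move=> w Bw; have [|] := pselect (X 0 w = x); [left|right].
- exact: measurableI.
- exact: measurableC.
Qed.

(** The events of the words violating Q are disjoint and miss B up to a null set, so P B is at most
    1 minus their weight. All words together weigh at least 1 - L (n h)^2, which leaves the words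
    satisfying Q and this defect. The event of two updates in one cell never has to be described. *)
Lemma cell_bound (h : R) (L : nat) (B : set Omega)
    (Q : pred (seq (cell_move V))) :
  0 < h -> measurable B ->
  (forall w c, B w -> X 0 w = x -> size c = L -> 
     (forall i, (i <= L)%N -> X (i%:R * h) w = run x (take i c)) ->
     (forall s, 0 <= s <= L%:R * h -> exists2 j, (j <= L)%N & X s w = run x (take j c)) ->
     Q c) ->
  (P B <= (\sum_(c <- words _ L | Q c) word_weight e alpha h c
            + L%:R * (n * h) ^+ 2)%:E)%E.
Proof.
move=> h0 mB BQ; have [mX P1 [N [M [noise evol]]]] := HX.
have [Np _ _ _] := noise.
have Nmono w v s t : 0 <= s <= t -> (N v s w <= N v t w)%N.
  by have [_ H _ _ _] := Np v; apply: H.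
have N0 w v : N v 0 w = 0%N by have [H _ _ _ _] := Np v; apply: H.
have Nr w v t : 0 <= t -> \forall s \near t^'+, N v s w = N v t w.
  by have [_ _ H _ _] := Np v; apply: H.
rewrite probability_on_start //.
pose cs := [seq c <- words _ L | ~~ Q c].
pose E := word_event N M h.
have := @sum_measure_disjoint_le1 R d Omega P _ E cs (B `&` X 0 @^-1` [set x]).
move=> /(_ _)/wrap[].
  by rewrite filter_uniq // words_uniq.
move=> /(_ _)/wrap[]; first by apply: measurableI => //; exact: mX.
move=> /(_ _)/wrap[]; first by move=> c; exact: (word_event_measurable noise h0).
move=> /(_ _)/wrap[].
  move=> c c' w; rewrite !mem_filter !mem_words.
  move=> /andP[_ /eqP cL] /andP[_ /eqP cL'] Fc Fc'.
  apply: (follows_inj h0 (N0 w) (Nmono w) Fc Fc').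
  by rewrite cL cL'.
move=> /(_ _)/wrap[].
  move=> c w; rewrite mem_filter mem_words => /andP[nQ /eqP cL] Fc [Bw Xw].
  move/negP: nQ; apply; apply: (BQ w) => //.
    move=> i iL; have ic : (i <= size c)%N by rewrite cL.
    by have [] := follows_run h0 (N0 w) (Nmono w) (Nr w) (evol w) Xw Fc ic.
  have [_ H] := follows_run h0 (N0 w) (Nmono w) (Nr w) (evol w) Xw Fc (leqnn _).
  by rewrite -cL; exact: H.
under eq_bigr do rewrite (word_event_prob noise h0).
rewrite sumEFin => le1.
have le2 : 1 - L%:R * (n * h) ^+ 2 <= \sum_(c <- words _ L) word_weight e alpha h c.
  by apply: sum_words_ge => //; exact: ltW.
have PBfin : P (B `&` X 0 @^-1` [set x]) \is a fin_num.
  by apply: fin_num_measure; apply: measurableI => //; exact: mX.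
move: le1; rewrite -(fineK PBfin) -EFinD !lee_fin => le1.
move: le2; rewrite -/n (bigID Q) /= => le2.
by rewrite /cs big_filter in le1; lra.
Qed.

Lemma ler_inverse_limit (a b c : R) : 0 <= c ->
  (forall L, a <= b + c / L.+1%:R) -> a <= b.
Proof.
move=> c0 H; apply/ler_addgt0Pr => eps eps0.
apply: le_trans (H (Num.truncn (c / eps))) _; rewrite lerD2l.
rewrite ler_pdivrMr ?ltr0n // mulrC -ler_pdivrMr //.
by apply/ltW/truncnS_gt.
Qed.

Lemma grid_limit (T : R) (B : set Omega) (b : R) :
  0 < T -> measurable B ->
  (forall L, (P B <= (b + L.+1%:R * (n * (T / L.+1%:R)) ^+ 2)%:E)%E) ->
  (P B <= b%:E)%E.
Proof.
move=> T0 mB H; have PBfin := fin_num_measure P B mB.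
rewrite -(fineK PBfin) lee_fin.
apply: (@ler_inverse_limit _ _ ((n * T) ^+ 2)); first exact: sqr_ge0.
move=> L; apply: le_trans (_ : _ <= b + L.+1%:R * (n * (T / L.+1%:R)) ^+ 2) _.
  by rewrite -lee_fin fineK.
rewrite (_ : L.+1%:R * _ = (n * T) ^+ 2 / L.+1%:R) //.
have : L.+1%:R != 0 :> R by rewrite pnatr_eq0.
by move: (L.+1%:R : R) => l l0; field.
Qed.

(** B is any event on which S is visited, which leaves measurability to the caller. *)
Lemma visit_probability (S : pred (state V)) (f : state V -> R)
    (f0 kappa T : R) (B : set Omega) :
  0 < T -> measurable B ->
  (forall w, X 0 w = x -> B w -> exists2 s, 0 <= s <= T & S (X s w)) ->
  (forall y, 0 <= f y) -> 0 <= kappa -> 0 < f0 -> (forall y, S y -> f0 <= f y) ->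
  (forall y, ~~ S y -> generator e alpha f y <= kappa) ->
  (P B <= ((f x + T * kappa) / f0)%:E)%E.
Proof.
move=> T0 mB BS fge0 k0 f00 fS fk; apply: (grid_limit T0) => // L.
have h0 : 0 < T / L.+1%:R by rewrite divr_gt0.
have Lh : L.+1%:R * (T / L.+1%:R) = T by rewrite mulrC divfK // pnatr_eq0.
apply: le_trans (@cell_bound _ L.+1 B (visits S x) h0 mB _) _.
  move=> w c Bw Xw cL _ Hrun; have [s] := BS w Xw Bw.
  rewrite -{1}Lh => /Hrun[j jL ->] Sj; apply/visitsP; exists j => //.
  by rewrite cL.
rewrite lee_fin lerD2r ler_pdivlMr // mulrC -[X in _ <= _ + X * _]Lh.
by apply: sum_words_visits => //; exact: ltW.
Qed.

(** S' is the level to be hit and S the region beyond it, off which f decays; a word that reaches S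
    has to pass through S'. Here the grid times alone suffice. *)
Lemma avoid_probability (S S' : pred (state V)) (f : state V -> R)
    (r T : R) (B : set Omega) :
  0 < T -> measurable B ->
  (forall w, X 0 w = x -> B w -> forall s, 0 <= s <= T -> ~~ S' (X s w)) ->
  (forall c, visits S x c -> visits S' x c) ->
  (forall y, 0 <= f y) -> (forall y, ~~ S y -> 1 <= f y) ->
  (forall y, ~~ S y -> generator e alpha f y <= - r * f y) ->
  (P B <= (expR (- (r * T)) * f x)%:E)%E.
Proof.
move=> T0 mB BS SS' fge0 f1 fr; apply: (grid_limit T0) => // L.
have h0 : 0 < T / L.+1%:R by rewrite divr_gt0.
have Lh : L.+1%:R * (T / L.+1%:R) = T by rewrite mulrC divfK // pnatr_eq0.
apply: le_trans (@cell_bound _ L.+1 B (fun c => ~~ visits S x c) h0 mB _) _.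
  move=> w c Bw Xw cL Hrun _; apply/negP => /SS'/visitsP[j].
  rewrite cL => jL; rewrite -Hrun //; apply/negP/BS => //.
  rewrite mulr_ge0 ?ler0n ?(ltW h0) //= -[leRHS]Lh ler_wpM2r ?(ltW h0) //.
  by rewrite ler_nat.
rewrite lee_fin lerD2r -[X in - (_ * X)]Lh.
by apply: sum_words_avoid => //; exact: ltW.
Qed.

Lemma right_continuous t w : 0 <= t -> \forall s \near t^'+, X s w = X t w.
Proof.
move=> t0; have [_ _ [N [M [[Np _ _ _] evol]]]] := HX.
have H (v : V) : \forall s \near t^'+, N v s w = N v t w.
  by have [_ _ Nr _ _] := Np v; apply: Nr.
apply: filterS2 (nbhs_right_gt t) (filter_forall _ H).
move=> s ts Hs; apply/ffunP => v; apply: (constant_opinion (evol w)).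
  by rewrite t0 ltW.
by rewrite Hs.
Qed.

(** Paths are right-continuous, so a visit persists until some slightly later rational time; the
    half-open interval leaves room for it. *)
Lemma visit_measurable (T : R) (S : set (state V)) :
  measurable [set w | exists2 s, 0 <= s < T & S (X s w)].
Proof.
have -> : [set w | exists2 s, 0 <= s < T & S (X s w)] =
    \bigcup_(q : rat) (if (0 <= ratr q :> R) && (ratr q < T) then X (ratr q) @^-1` S else set0).
  apply/seteqP; split=> w; last first.
    by move=> [q _]; case: ifP => // qT Sq; exists (ratr q).
  move=> [s /andP[s0 sT] Ss].
  have [r r0 Hr] := near_rightP (right_continuous w s0).
  have [q] : exists q, ratr q \in `]s, Num.min (s + r) T[.
    by apply: rat_in_itvoo; rewrite lt_min sT ltrDl r0.
  rewrite in_itv /= lt_min => /and3P[sq qr qT].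
  exists q => //; rewrite (le_trans s0 (ltW sq)) qT /= (Hr (ratr q)) //.
  by rewrite sq.
apply: bigcupT_measurable_rat => q; case: ifP => // /andP[q0 _].
exact: state_measurable.
Qed.

End TwoChoices.

(** * Degrees, sizes and drift along the family of graphs *)

Lemma degree_gt0 (V : finType) (e : rel V) : (1 < #|V|)%N ->
  simple_connected_graph e -> forall v, (0 < degree e v)%N.
Proof.
move=> V1 [_ _ conn] v.
have [w wv] : exists w, w != v.
  have /card_gt1P[a [b [_ _ ab]]] := V1.
  have [av|av] := eqVneq a v; last by exists a.
  by exists b; rewrite -av eq_sym.
have /connectP[[|u p] /= ] := conn v w; first by move=> _ E; rewrite E eqxx in wv.
by case/andP=> vu _ _; apply/card_gt0P; exists u; rewrite inE.
Qed.

Lemma degree_le_max (V : finType) (e : rel V) v : (degree e v <= max_degree e)%N.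
Proof. exact: leq_bigmax. Qed.

Lemma min_degree_le (V : finType) (e : rel V) v : (min_degree e <= degree e v)%N.
Proof.
rewrite /min_degree; elim: (index_enum V) (mem_index_enum v) => // u s IH.
rewrite inE big_cons => /predU1P[->|/IH]; first exact: geq_minl.
exact/leq_trans/geq_minr.
Qed.

Lemma min_degree_gt0 (V : finType) (e : rel V) : (0 < #|V|)%N ->
  (forall v, (0 < degree e v)%N) -> (0 < min_degree e)%N.
Proof.
move=> V0 dv; rewrite /min_degree; elim/big_ind: _ => // a b a0 b0.
by rewrite leq_min a0.
Qed.

Section Family.
Variables (R : realType) (V : nat -> finType) (e : forall k, rel (V k)).
Arguments e : clear implicits.
Variable alpha : R.
Hypothesis hexpander : expander_family R e.
Hypothesis hlambda : (fun k => second_eigenvalue R (e k)) @ \oo --> (0 : R).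
Hypothesis hdegree :
  (fun k => (max_degree (e k))%:R / (min_degree (e k))%:R : R) @ \oo --> (1 : R).
Hypothesis alpha01 : 0 <= alpha <= 1.

Lemma family_degree_gt0 k (v : V k) : (0 < degree (e k) v)%N.
Proof. by have [/(_ k)[V1 G] _ _] := hexpander; apply: degree_gt0. Qed.

Lemma family_size k : (k < #|V k|)%N.
Proof.
have [H Vlt _] := hexpander; elim: k => [|k IH]; first by have [/ltnW] := H 0%N.
by apply: leq_ltn_trans IH (Vlt _ _ (ltnSn k)).
Qed.

Lemma family_size_near (K : R) : \forall k \near \oo, K <= #|V k|%:R.
Proof.
exists (Num.truncn K).+1 => // k /= Kk.
apply: (@le_trans _ _ k%:R); last by rewrite ler_nat ltnW // family_size.
by apply: le_trans (ltW (truncnS_gt K)) _; rewrite ler_nat.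
Qed.

Lemma family_drift (eta : R) : 0 < eta ->
  \forall k \near \oo, forall b (x : state (V k)) (p : R),
    #|V k|%:R * p = (count_of b x)%:R ->
    `|rate_to (e k) alpha b x - rate_to (e k) alpha (~~ b) x
      - #|V k|%:R * limit_drift alpha p| <= eta * #|V k|%:R.
Proof.
(* [drift_error] doubles the bound 3 eps n of [mean_deviation], whence eta / 6; the cap 1 / 2 keeps
   the second eigenvalue below 1. *)
move=> eta0; pose eps : R := Num.min (eta / 6) (1 / 2).
have eps0 : 0 < eps by rewrite lt_min; apply/andP; split; lra.
have eps1 : eps <= 1 / 2 by rewrite ge_min lexx orbT.
have eps6 : 6 * eps <= eta.
  have : eps <= eta / 6 by rewrite ge_min lexx.
  by move=> ?; lra.
have /cvgrPdist_le /(_ eps eps0) near_l := hlambda.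
have /cvgrPdist_le /(_ eps eps0) near_d := hdegree.
near=> k => b x p pE.
have lk : `|0 - second_eigenvalue R (e k)| <= eps by near: k.
have dk : `|1 - (max_degree (e k))%:R / (min_degree (e k))%:R : R| <= eps by near: k.
have [/(_ k)[V1 [e_sym _ _]] _ _] := hexpander.
have deg := @family_degree_gt0 k.
have dmin0 : 0 < (min_degree (e k))%:R :> R.
  by rewrite ltr0n min_degree_gt0 // ltnW.
apply: le_trans (drift_error alpha01 deg pE) _.
have l0 := second_eigenvalue_ge0 R (e k).
rewrite sub0r normrN ger0_norm // in lk.
have : \sum_v `|neighbor_mean (e k) (has_op R b x) v - p| <= 3 * eps * #|V k|%:R.
  apply: (@mean_deviation _ _ _ deg b x eps p (min_degree (e k))%:R (max_degree (e k))%:R) => //.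
  - by rewrite eps0; lra.
  - by lra.
  - by rewrite -ler_pdivrMr //; move: dk; rewrite ler_norml => /andP[]; lra.
  - by move=> v; rewrite !ler_nat min_degree_le degree_le_max.
have n0 : 0 <= #|V k|%:R :> R by [].
by nra.
Unshelve. all: by end_near.
Qed.

End Family.

(** * Metastability below the threshold *)

(** exp(y) <= 1 / (1 - y), and (1 + y + 2 y^2) (1 - y) = 1 + y^2 (1 - 2 y) >= 1. *)
Lemma expR_le_quadratic (R : realType) (y : R) : `|y| <= 1 / 2 ->
  expR y - 1 <= y + 2 * y ^+ 2.
Proof.
rewrite ler_norml => /andP[y1 y2].
have H : expR y * (1 - y) <= 1.
  have : 1 - y <= expR (- y) by exact: expR_ge1Dx.
  by rewrite expRN -ler_pdivlMl ?expR_gt0 // mulr1.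
have E0 := expR_gt0 y.
have : expR y * (1 - y) <= (1 + y + 2 * y ^+ 2) * (1 - y) by nra.
by rewrite ler_pM2r; lra.
Qed.

Section Escape.
Variables (R : realType) (V : finType) (e : rel V) (alpha : R).
Hypotheses (alpha01 : 0 <= alpha <= 1) (deg_gt0 : forall v, (0 < degree e v)%N).
Implicit Types (x y : state V).

Let n : R := #|V|%:R.

Lemma rate_to_eq0 b x : count_of b x = 0%N -> rate_to e alpha (~~ b) x = 0.
Proof.
move=> /eqP; rewrite cards_eq0 => /eqP E; rewrite /rate_to big_pred0 // => v.
have : v \notin [set v | x v == b]%SET by rewrite E inE.
by rewrite inE; case: (x v); case: b {E}.
Qed.

Lemma generator_expR (b : bool) (theta : R) x :
  generator e alpha (fun y => expR (theta * (count_of b y)%:R)) x =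
  expR (theta * (count_of b x)%:R) *
  (rate_to e alpha b x * (expR theta - 1)
   + rate_to e alpha (~~ b) x * (expR (- theta) - 1)).
Proof.
rewrite (generator_count e alpha b (fun a => expR (theta * a%:R))).
case E : (count_of b x) => [|a] /=.
  rewrite (rate_to_eq0 E) !mul0r !addr0 mulr0 mulr1 expR0; ring.
have -> : expR (theta * a.+2%:R) = expR (theta * a.+1%:R) * expR theta.
  by rewrite -expRD; congr expR; rewrite -[a.+2%:R]natr1; ring.
have -> : expR (theta * a%:R) = expR (theta * a.+1%:R) * expR (- theta).
  by rewrite -expRD; congr expR; rewrite -[a.+1%:R]natr1; ring.
ring.
Qed.

(** Between m and top the second-order terms, at most 4 theta^2 n, are paid for by the drift theta c
    n, whence 4 theta <= c. Below m the sign of the drift is unknown, but the crude bound there is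
    harmless: exp(theta m) is exponentially smaller than the value at top. *)
Lemma generator_expR_le (b : bool) (theta c m top : R) x :
  0 < theta <= 1 / 2 -> 4 * theta <= c ->
  (m < (count_of b x)%:R < top ->
    rate_to e alpha b x - rate_to e alpha (~~ b) x <= - c * n) ->
  (count_of b x)%:R < top ->
  generator e alpha (fun y => expR (theta * (count_of b y)%:R)) x <=
  2 * n * expR (theta * m).
Proof.
move=> /andP[t0 t1] tc drift xtop; rewrite generator_expR.
have up0 := rate_to_ge0 e alpha01 b x; have up1 := rate_to_le alpha01 deg_gt0 b x.
have dn0 := rate_to_ge0 e alpha01 (~~ b) x.
have dn1 := rate_to_le alpha01 deg_gt0 (~~ b) x.
have n0 : 0 <= n by [].
have e1 : expR theta - 1 <= theta + 2 * theta ^+ 2.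
  by apply: expR_le_quadratic; rewrite gtr0_norm.
have e2 : expR (- theta) - 1 <= - theta + 2 * theta ^+ 2.
  by rewrite -[theta ^+ 2]sqrrN; apply: expR_le_quadratic; rewrite normrN gtr0_norm.
move: drift; rewrite xtop andbT.
have E0 a : 0 <= expR a := expR_ge0 a.
case: ltP => [mx /(_ isT) drift|xm _].
  apply: (@le_trans _ _ 0); last by rewrite !mulr_ge0.
  rewrite mulr_ge0_le0 //.
  have : rate_to e alpha b x * (expR theta - 1) <=
      rate_to e alpha b x * (theta + 2 * theta ^+ 2) by rewrite ler_wpM2l.
  have : rate_to e alpha (~~ b) x * (expR (- theta) - 1) <=
      rate_to e alpha (~~ b) x * (- theta + 2 * theta ^+ 2) by rewrite ler_wpM2l.
  rewrite -/n in up1 dn1.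
  move: drift up0 up1 dn0 dn1.
  move: (rate_to e alpha b x) (rate_to e alpha (~~ b) x) => u w dr u0 u1 w0 w1 H1 H2.
  have H3 : theta * (u - w) <= theta * (- c * n) by rewrite ler_wpM2l // ltW.
  have H4 : theta ^+ 2 * (u + w) <= theta ^+ 2 * (2 * n) by rewrite ler_wpM2l ?sqr_ge0 //; lra.
  have H5 : (4 * theta) * (theta * n) <= c * (theta * n).
    by rewrite ler_wpM2r // mulr_ge0 // ltW.
  lra.
have e3 : expR (- theta) - 1 <= 0 by rewrite subr_le0 expR_le1; lra.
rewrite [leRHS]mulrC; apply: (@le_trans _ _ (expR (theta * (count_of b x)%:R) * (2 * n))).
  rewrite ler_wpM2l //.
  have H1 : rate_to e alpha (~~ b) x * (expR (- theta) - 1) <= 0 by rewrite mulr_ge0_le0.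
  have H2 : rate_to e alpha b x * (expR theta - 1) <= n * 1.
    apply: ler_pM => //; first by rewrite subr_ge0 -expR0 ler_expR ltW.
    by apply: le_trans e1 _; nra.
  lra.
by rewrite ler_wpM2r ?mulr_ge0 // ler_expR ler_wpM2l // ltW.
Qed.

End Escape.

Lemma expR_ge_quarter_sqr (R : realType) (y : R) : 0 <= y -> y ^+ 2 / 4 <= expR y.
Proof.
move=> y0; have H : 1 + y / 2 <= expR (y / 2) by exact: expR_ge1Dx.
have -> : expR y = expR (y / 2) * expR (y / 2) by rewrite -expRD; congr expR; field.
by nra.
Qed.

(** 1 - 2 p is at least 2 delta, and p (1 - p) >= 1/4 - 4 delta^2. The bound on delta keeps half of
    the value - (1 - 3 alpha) / 4 that the second factor has at 1/2. *)
Lemma limit_drift_le (R : realType) (alpha delta p : R) :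
  0 < alpha < 1 -> 0 < delta -> delta <= (1 - 3 * alpha) / 8 ->
  1 / 2 - 2 * delta <= p <= 1 / 2 - delta ->
  limit_drift alpha p <= - (delta * (1 - 3 * alpha) / 4).
Proof.
move=> /andP[a0 a1] d0 d1 /andP[p1 p2]; rewrite /limit_drift.
have H : alpha / 2 - (1 - alpha) * (p * (1 - p)) <= - ((1 - 3 * alpha) / 8).
  have : 1 / 4 - 4 * delta ^+ 2 <= p * (1 - p) by nra.
  have : 4 * delta ^+ 2 <= (1 - 3 * alpha) / 8 by nra.
  move: (p * (1 - p)) => q; nra.
move: H; move: (_ - _ * (p * _)) => z H; nra.
Qed.

Section MetastableFamily.
Variables (R : realType) (V : nat -> finType) (e : forall k, rel (V k)).
Arguments e : clear implicits.
Variable alpha : R.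
Variables (d : nat -> measure_display) (Omega : forall k, measurableType (d k)).
Variables (P : forall k, state (V k) -> probability (Omega k) R).
Arguments P : clear implicits.
Variables (X : forall k, R -> Omega k -> state (V k)).
Arguments X : clear implicits.
Hypothesis hexpander : expander_family R e.
Hypothesis hlambda : (fun k => second_eigenvalue R (e k)) @ \oo --> (0 : R).
Hypothesis hdegree :
  (fun k => (max_degree (e k))%:R / (min_degree (e k))%:R : R) @ \oo --> (1 : R).
Hypothesis halpha : 0 < alpha < 1.
Hypothesis hX : forall k x, two_choices (e k) alpha (P k x) x (X k).

Let n k : R := #|V k|%:R.

Let alpha01 : 0 <= alpha <= 1.
Proof. by case/andP: halpha => a0 a1; rewrite !ltW. Qed.

Lemma escape_probability (delta : R) : alpha < 3^-1 ->
  0 < delta -> delta <= (1 - 3 * alpha) / 8 ->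
  exists a K : R, [/\ 0 < a, 0 < K & \forall k \near \oo,
    forall (b : bool) (x : state (V k)) (T : R) (B : set (Omega k)),
      (count_of b x)%:R <= (1 / 2 - 2 * delta) * n k + 1 ->
      0 < T -> T <= expR (a * n k) -> measurable B ->
      (forall w, X k 0 w = x -> B w -> exists2 s, 0 <= s <= T &
         (1 / 2 - delta) * n k <= (count_of b (X k s w))%:R) ->
      (P k x B <= (K / n k)%:E)%E].
Proof.
move=> a3 d0 d1; case/andP: (halpha) => a0 a1.
have a3' : 0 < 1 - 3 * alpha by lra.
(* c is half of the bound of [limit_drift_le]; the other half absorbs the error of [family_drift].
   The choice of a makes the barrier factor exp(theta (top - m)) equal to exp(2 a n). *)
pose c := delta * (1 - 3 * alpha) / 8; pose theta := c / 4; pose a := theta * delta / 2.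
have c0 : 0 < c by rewrite /c divr_gt0 // mulr_gt0.
have c1 : c <= 1 by rewrite /c; nra.
have t0 : 0 < theta by rewrite /theta; lra.
have t1 : theta <= 1 / 2 by rewrite /theta; lra.
have a_gt0 : 0 < a by rewrite /a divr_gt0 // mulr_gt0.
exists a, (20 / a ^+ 2); split=> //; first by rewrite divr_gt0 ?exprn_gt0.
have := family_drift hexpander hlambda hdegree alpha01 c0.
apply: filterS => k drift b x T B xm T0 Ta mB BS.
have nk : 1 <= n k by rewrite /n ler1n; apply: leq_ltn_trans (family_size hexpander k).
have n0 : 0 < n k by lra.
pose m := (1 / 2 - 2 * delta) * n k; pose top := (1 / 2 - delta) * n k.
pose f (y : state (V k)) := expR (theta * (count_of b y)%:R).
have gen (y : state (V k)) : ~~ (top <= (count_of b y)%:R) ->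
    generator (e k) alpha f y <= 2 * n k * expR (theta * m).
  rewrite -ltNge => ytop.
  apply: (@generator_expR_le _ _ _ _ alpha01 _ b theta c m top y) => //.
  - by move=> v; exact: (family_degree_gt0 hexpander).
  - by rewrite t0.
  - by rewrite /theta; lra.
  move=> /andP[my _]; pose p := (count_of b y)%:R / n k.
  have pE : n k * p = (count_of b y)%:R by rewrite mulrC divfK // gt_eqF.
  have := drift b y p pE; rewrite ler_norml => /andP[_].
  have : limit_drift alpha p <= - (delta * (1 - 3 * alpha) / 4).
    apply: limit_drift_le => //; rewrite ler_pdivlMr // ler_pdivrMr //.
    by rewrite -/m -/top !ltW.
  rewrite -/(n k) => H1; have := ler_wpM2l (ltW n0) H1; rewrite /c; lra.
have deg v := family_degree_gt0 hexpander (k := k) v.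
have := @visit_probability R (V k) (e k) alpha alpha01 deg _ _ _ x (X k) (hX x)
  (fun y => top <= (count_of b y)%:R) f (expR (theta * top))
  (2 * n k * expR (theta * m)) T B T0 mB BS.
move=> H; apply: le_trans (H _ _ _ _ gen) _ => //; rewrite ?expR_gt0 //.
- by move=> y; exact: expR_ge0.
- by rewrite !mulr_ge0 ?expR_ge0 // ltW.
- by move=> y ytop; rewrite /f ler_expR ler_wpM2l // ltW.
rewrite lee_fin; pose E := expR (a * n k); pose F := expR (theta * m).
have F0 : 0 < F := expR_gt0 _.
have an0 : 0 <= a * n k by rewrite mulr_ge0 // ltW.
have E1 : 1 <= E by rewrite -expR0 ler_expR.
have topE : expR (theta * top) = F * (E * E).
  by rewrite -!expRD; congr expR; rewrite /top /m /a; field.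
(* The extra 1 in the starting level, which allows for rounding, costs exp(theta) <= 2. *)
have fx : f x <= F * 2.
  apply: (@le_trans _ _ (F * expR theta)).
    by rewrite -expRD ler_expR -[X in _ + X]mulr1 -mulrDr ler_wpM2l // ltW.
  rewrite ler_wpM2l ?(ltW F0) //.
  have : `|theta| <= 1 / 2 by rewrite gtr0_norm.
  by move/expR_le_quadratic; nra.
have quad := expR_ge_quarter_sqr an0; rewrite -/E in quad.
have num : f x + T * (2 * n k * F) <= F * (4 * n k * E).
  have : T * (2 * n k * F) <= E * (2 * n k * F).
    by rewrite ler_wpM2r // !mulr_ge0 // ltW.
  have : F * 2 <= F * (2 * n k * E) by rewrite ler_wpM2l ?(ltW F0) //; nra.
  lra.
(* Of the two factors E in the denominator, one pays for the time T <= E; the other, at least (a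
   n)^2 / 4, beats the factor n. *)
rewrite topE; apply: (@le_trans _ _ (F * (4 * n k * E) / (F * (E * E)))).
  by rewrite ler_wpM2r // invr_ge0 !mulr_ge0 //; lra.
have E0 : 0 < E by lra.
rewrite (_ : F * _ / _ = 4 * n k / E); last by field; rewrite !gt_eqF.
rewrite ler_pdivrMr // mulrAC ler_pdivlMr //.
rewrite (_ : 20 / a ^+ 2 * E = 20 * E / a ^+ 2); last by rewrite mulrAC.
by rewrite ler_pdivlMr ?exprn_gt0 //; nra.
Qed.

Lemma hitting_time_geP (k : nat) (S : set (state (V k))) (T : R) (w : Omega k) :
  (T%:E <= hitting_time (X k) S w)%E <->
  ~ (exists2 s, 0 <= s < T & S (X k s w)).
Proof.
split=> [Tle [s /andP[s0 sT] Ss]|H].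
  have : (T%:E <= s%:E)%E.
    by apply: le_trans Tle _; apply: ereal_inf_lbound; exists s.
  by rewrite lee_fin leNgt sT.
apply: le_ereal_inf_tmp => _ [s [s0 Ss] <-]; rewrite lee_fin leNgt; apply/negP => sT.
by apply: H; exists s; rewrite // s0.
Qed.

Lemma count_onesE k (x : state (V k)) : count_ones x = count_of true x.
Proof. by apply: eq_card => v; rewrite !inE eqb_id. Qed.

(** Rounding n / 2 costs less than 1 <= delta n, and passing to the other opinion swaps floor and
    ceiling. *)
Lemma half_level_count (k : nat) (delta : R) b (x : state (V k)) :
  1 <= delta * n k -> half_level x -> (1 / 2 - delta) * n k <= (count_of b x)%:R.
Proof.
move=> dn; have nE : (#|V k|./2 + uphalf #|V k|)%:R = n k.
  by rewrite uphalf_half addnCA addnn odd_double_half.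
have le1 : (#|V k|./2 <= uphalf #|V k|)%N by rewrite uphalf_half leq_addl.
have le2 : (uphalf #|V k| <= #|V k|./2.+1)%N.
  by rewrite uphalf_half -add1n leq_add2r; case: odd.
move: nE le1 le2; rewrite natrD -(ler_nat R) -(ler_nat R (uphalf _)) -natr1.
rewrite /half_level /= count_onesE => nE le1 le2.
case: b; first by case=> ->; lra.
by rewrite (count_ofN R true) -/(n k); case=> ->; lra.
Qed.

Lemma cvg_to_one (u : nat -> \bar R) (K : R) : 0 < K ->
  (\forall k \near \oo, ((1 - K / n k)%:E <= u k)%E) ->
  (forall k, (u k <= 1)%E) -> u @ \oo --> 1%E.
Proof.
move=> K0 lo hi.
have lim1 : (fun k => (1 - K / n k)%:E) @ \oo --> (1%:E : \bar R).
  apply: cvg_EFin; first exact: nearW.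
  apply/cvgrPdist_le => eps eps0.
  have := family_size_near hexpander (K / eps); apply: filterS => k Kn.
  have n0 : 0 < n k by rewrite ltr0n; apply: leq_ltn_trans (family_size hexpander k).
  rewrite /= opprB addrC subrK ger0_norm; last by rewrite divr_ge0 ?ltW.
  by rewrite ler_pdivrMr // mulrC -ler_pdivrMr.
apply: (squeeze_cvge _ lim1 (cvg_cst (1%:E))).
by apply: filterS lo => k ->; rewrite hi.
Qed.

Lemma slow_hitting (eps : R) : alpha < 3^-1 -> 0 < eps ->
  exists (g : nat -> R) (c : R),
    [/\ pos_Theta (fun k => #|V k|) g, 0 < c &
    forall p : R, 0 <= p < 2^-1 - eps \/ 2^-1 + eps < p <= 1 ->
    forall x : forall k, state (V k),
      (forall k, (count_ones (x k))%:Z = Num.ceil (#|V k|%:R * p)) ->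
      (fun k => P k (x k)
         [set w | ((c * expR (g k))%:E <=
                   hitting_time (X k) (@half_level (V k)) w)%E])
        @ \oo --> 1%E].
Proof.
move=> a3 eps0; pose delta := Num.min (eps / 2) ((1 - 3 * alpha) / 8).
have d0 : 0 < delta by rewrite lt_min; apply/andP; split; lra.
have d1 : delta <= (1 - 3 * alpha) / 8 by rewrite ge_min lexx orbT.
have d2 : 2 * delta <= eps.
  have : delta <= eps / 2 by rewrite ge_min lexx.
  by move=> ?; lra.
have [a [K [a0 K0 esc]]] := escape_probability a3 d0 d1.
exists (fun k => a * n k), 1; split=> //.
  by exists a, a; split=> //; apply: nearW => k; rewrite lexx.
move=> p pP x xE.
pose B k := [set w | exists2 s, 0 <= s < expR (a * n k) & half_level (X k s w)].
have mB k : measurable (B k) by exact: (visit_measurable (hX (x k))).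
have BC k : [set w | ((1 * expR (a * n k))%:E <=
    hitting_time (X k) (@half_level (V k)) w)%E] = ~` B k.
  by rewrite mul1r; apply/seteqP; split=> w /= H; apply/hitting_time_geP.
under eq_fun do rewrite BC.
apply: (@cvg_to_one _ K) => //; last first.
  by move=> k; apply/probability_le1/measurableC.
have := family_size_near hexpander delta^-1.
apply: filterS2 esc => k esc nk.
have nd : 1 <= delta * n k by rewrite mulrC -ler_pdivrMr // mul1r.
have T0 : 0 < expR (a * n k) := expR_gt0 _.
rewrite probability_setC // EFinB leeB //.
have n0 : 0 < n k by rewrite ltr0n; apply: leq_ltn_trans (family_size hexpander k).
have ceilE : (count_of true (x k))%:R = (Num.ceil (n k * p))%:~R :> R.
  by rewrite -count_onesE -xE.
have c1 : (Num.ceil (n k * p))%:~R < n k * p + 1.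
  by have := ceilB1_lt (n k * p); rewrite intrB ltrBlDr.
have c2 : n k * p <= (Num.ceil (n k * p))%:~R := ceil_ge _.
(* The minority opinion at the start: 1 for small p, 0 for large p. It has to climb to the half
   level. *)
have [b xb] : exists b, (count_of b (x k))%:R <= (1 / 2 - 2 * delta) * n k + 1.
  case: pP => /andP[p1 p2].
    exists true; rewrite ceilE; apply: le_trans (ltW c1) _; rewrite lerD2r mulrC.
    by rewrite ler_wpM2r //; lra.
  exists false; rewrite (count_ofN R true) ceilE -/(n k).
  have : (1 / 2 + 2 * delta) * n k <= p * n k by rewrite ler_wpM2r //; lra.
  by lra.
apply: (esc b (x k) (expR (a * n k))) => // w _ [s /andP[s0 sT] Hs].
by exists s; [rewrite s0 ltW|apply: half_level_count].
Qed.

End MetastableFamily.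

(** * Lower bound on the mixing time *)

Section MixingFamily.
Variables (R : realType) (V : nat -> finType) (e : forall k, rel (V k)).
Arguments e : clear implicits.
Variable alpha : R.
Variables (d : nat -> measure_display) (Omega : forall k, measurableType (d k)).
Variables (P : forall k, state (V k) -> probability (Omega k) R).
Arguments P : clear implicits.
Variables (X : forall k, R -> Omega k -> state (V k)).
Arguments X : clear implicits.
Variable pi : forall k, state (V k) -> R.
Arguments pi : clear implicits.
Hypothesis hexpander : expander_family R e.
Hypothesis hlambda : (fun k => second_eigenvalue R (e k)) @ \oo --> (0 : R).
Hypothesis hdegree :
  (fun k => (max_degree (e k))%:R / (min_degree (e k))%:R : R) @ \oo --> (1 : R).
Hypothesis halpha : 0 < alpha < 1.
Hypothesis hX : forall k x, two_choices (e k) alpha (P k x) x (X k).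

Let n k : R := #|V k|%:R.

Lemma distance_ge k t (x : state (V k)) (S : {set state (V k)}) :
  `|transition (P k) (X k) t x S - \sum_(y in S) pi k y|
  <= distance_to_stationarity (P k) (X k) (pi k) t.
Proof.
apply: le_trans (le_bigmax _ _ x) => /=.
exact: (le_bigmax _ (fun S => `|transition (P k) (X k) t x S - \sum_(y in S) pi k y|)).
Qed.

(* The two consensus configurations stay on their own side of the majority
   level, so that their laws remain far apart. *)
Lemma slow_mixing : alpha < 3^-1 ->
  Omega_exp_Theta (fun k => #|V k|) (fun k => mixing_time (P k) (X k) (pi k)).
Proof.
move=> a3; pose delta := Num.min (1 / 8) ((1 - 3 * alpha) / 8).
have d0 : 0 < delta by rewrite lt_min; apply/andP; split; lra.
have d1 : delta <= (1 - 3 * alpha) / 8 by rewrite ge_min lexx orbT.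
have d2 : delta <= 1 / 8 by rewrite ge_min lexx.
have [a [K [a0 K0 esc]]] :=
  escape_probability hexpander hlambda hdegree halpha hX a3 d0 d1.
exists (fun k => a * n k), 1; split=> //.
  by exists a, a; split=> //; apply: nearW => k; rewrite lexx.
(* Each start then crosses with probability at most 1 / 8, so S has probability at most 1 / 8 from
   one start and at least 7 / 8 from the other. Both being within 1 / 4 of the stationary mass of S
   would force 3 / 4 <= 1 / 2. *)
have := family_size_near hexpander (8 * K).
apply: filterS2 esc => k esc nk.
have n0 : 0 < n k by rewrite ltr0n; apply: leq_ltn_trans (family_size hexpander k).
have Kn : K / n k <= 1 / 8 by rewrite ler_pdivrMr // mulrC; rewrite -/(n k) in nk; lra.
rewrite mul1r; apply: le_ereal_inf_tmp => _ [t [t0 dt] <-]; rewrite lee_fin leNgt.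
apply/negP => tT.
pose S : {set state (V k)} := [set y | n k <= 2 * (count_of true y)%:R]%SET.
have T0 : 0 < expR (a * n k) := expR_gt0 _.
pose x0 b : state (V k) := [ffun=> ~~ b].
have cx0 b : count_of b (x0 b) = 0%N.
  by apply: eq_card0 => v; rewrite !inE ffunE; case: b.
have m0 : 0 <= (1 / 2 - 2 * delta) * n k by rewrite mulr_ge0 ?(ltW n0) //; lra.
have low b (B : set (Omega k)) : measurable B ->
    (forall w, B w -> n k <= 2 * (count_of b (X k t w))%:R) ->
    (P k (x0 b) B <= (1 / 8)%:E)%E.
  move=> mB BS; apply: (@le_trans _ _ (K / n k)%:E); last by rewrite lee_fin.
  apply: (esc b _ (expR (a * n k))) => //; first by rewrite cx0; lra.
  move=> w _ Bw; exists t; first by rewrite t0 ltW.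
  have := BS w Bw; have : 0 <= delta * n k by rewrite mulr_ge0 // ltW.
  by lra.
have mS x : measurable (X k t @^-1` [set` S]) := state_measurable (hX x) _ t0.
have ptrue : transition (P k) (X k) t (x0 true) S <= 1 / 8.
  rewrite /transition -lee_fin fineK ?fin_num_measure //; last exact: mS (x0 true).
  apply: low; first exact: mS (x0 true).
  by move=> w /=; rewrite inE.
have pfalse : 7 / 8 <= transition (P k) (X k) t (x0 false) S.
  have mS' := mS (x0 false).
  have : (P k (x0 false) (~` (X k t @^-1` [set` S])) <= (1 / 8)%:E)%E.
    apply: low; first exact: measurableC.
    move=> w /=; rewrite inE => /negP; rewrite -ltNge (count_ofN R true) -/(n k).
    by lra.
  rewrite probability_setC // /transition.
  rewrite -[P k (x0 false) _ in X in X -> _]fineK ?fin_num_measure //.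
  rewrite -EFinB lee_fin; lra.
have := le_trans (distance_ge t (x0 true) S) dt.
have := le_trans (distance_ge t (x0 false) S) dt.
by rewrite !ler_norml => /andP[_ H1] /andP[H2 _]; lra.
Qed.

End MixingFamily.

(** * Hitting times above the threshold *)

(** Directly from the integral as a supremum over simple functions, so that it applies to hitting
    times without first proving them measurable. *)
Lemma ge0_integral_mono (d : measure_display) (T : measurableType d)
    (R : realType) (mu : {measure set T -> \bar R}) (f g : T -> \bar R) :
  (forall w, 0 <= f w)%E -> (forall w, f w <= g w)%E ->
  (\int[mu]_w f w <= \int[mu]_w g w)%E.
Proof.
move=> f0 fg; have g0 w : (0 <= g w)%E := le_trans (f0 w) (fg w).
rewrite !ge0_integralTE //; apply: ereal_sup_le => _ [h /= hf <-].
by exists h => //= w; apply: le_trans (fg w).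
Qed.

Section ExpectedHitting.
Variables (R : realType) (V : finType) (e : rel V) (alpha : R).
Variables (d : measure_display) (Omega : measurableType d).
Variables (P : probability Omega R) (x : state V) (X : R -> Omega -> state V).
Hypothesis HX : two_choices e alpha P x X.

Lemma hitting_time_ge0 (S : set (state V)) w : (0 <= hitting_time X S w)%E.
Proof. by apply: le_ereal_inf_tmp => _ [s [s0 _] <-]; rewrite lee_fin. Qed.

Lemma hitting_time_mono (S S' : set (state V)) w :
  S `<=` S' -> (hitting_time X S' w <= hitting_time X S w)%E.
Proof.
move=> SS'; apply: le_ereal_inf_tmp => _ [s [s0 Ss] <-].
by apply: ereal_inf_lbound; exists s => //; split=> //; apply: SS'.
Qed.

Definition avoids (S : set (state V)) (j : nat) : set Omega :=
  [set w | forall s, 0 <= s <= j%:R -> ~ S (X s w)].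

Lemma avoids_measurable S j : measurable (avoids S j).
Proof.
have -> : avoids S j = ~` ([set w | exists2 s, 0 <= s < j%:R & S (X s w)]
                           `|` X j%:R @^-1` S).
  apply/seteqP; split=> w /=.
    move=> H [[s /andP[s0 sj]]|]; first by apply: H; rewrite s0 ltW.
    by apply: H; rewrite lexx ler0n.
  move=> H s /andP[s0]; rewrite le_eqVlt => /predU1P[->|sj] Ss; apply: H.
    by right.
  by left; exists s; rewrite ?s0.
apply/measurableC/measurableU; first exact: (visit_measurable HX).
by apply: (state_measurable HX).
Qed.

(** The integer form of the tail formula for expectations: if J is the first integer such that S is
    visited during [0, J], the first J indicators are 1 and the hitting time is at most J. Without a
    visit the sum diverges. *)
Lemma hitting_time_le_sum S w :
  (hitting_time X S w <= \sum_(0 <= j <oo) (\1_(avoids S j) w)%:E)%E.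
Proof.
have ind0 j : (0 <= (\1_(avoids S j) w)%:E :> \bar R)%E by rewrite lee_fin.
have partial J : (forall j, (j < J)%N -> avoids S j w) ->
    (J%:R%:E <= \sum_(0 <= j <oo) (\1_(avoids S j) w)%:E :> \bar R)%E.
  move=> HJ; apply: le_trans (nneseries_lim_ge J _) => //.
  rewrite big_mkord (eq_bigr (fun=> 1%:E)); last first.
    by move=> [j jJ] _ /=; rewrite indicE mem_set //; apply: HJ.
  by rewrite sumEFin sumr_const card_ord.
have [all_j|/existsNP hit] := pselect (forall j, avoids S j w).
  rewrite (_ : (\sum_(0 <= j <oo) _)%E = +oo%E) ?leey //.
  apply: eq_infty => r; apply: le_trans (partial (Num.truncn r).+1 _) => //.
  by rewrite lee_fin ltW // truncnS_gt.
have hitb : exists j, `[< ~ avoids S j w >] by case: hit => j ?; exists j; apply/asboolP.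
case: (ex_minnP hitb) => J /asboolP /existsNP[s /not_implyP[/andP[s0 sJ] /contrapT Ss]] Jmin.
apply: (@le_trans _ _ J%:R%:E).
  apply: (@le_trans _ _ s%:E); last by rewrite lee_fin.
  by apply: ereal_inf_lbound; exists s.
apply: partial => j jJ; apply: contrapT => nj.
by have := Jmin j; rewrite leqNgt jJ => /(_ _)/negP; apply=> //; apply/asboolP.
Qed.

Lemma expected_hitting_le S (K q : R) : 0 <= K -> 0 <= q < 1 ->
  (forall j, (P (avoids S j) <= (K * q ^+ j)%:E)%E) ->
  (\int[P]_w hitting_time X S w <= (K / (1 - q))%:E)%E.
Proof.
move=> K0 /andP[q0 q1] HP.
apply: le_trans (ge0_integral_mono _ (hitting_time_ge0 S) (hitting_time_le_sum S)) _.
have mj j := avoids_measurable S j.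
rewrite integral_nneseries //; last first.
  by move=> j; apply/measurable_realfun.measurable_EFinP/measurable_realfun.measurable_indic.
under eq_eseriesr => j _ do rewrite integral_indic // setIT.
apply: lime_le; first by apply: is_cvg_nneseries => j _ _; exact: measure_ge0.
apply: nearW => J; rewrite big_mkord.
apply: (@le_trans _ _ (\sum_(j < J) (K * q ^+ j)%:E)%E); first by apply: lee_sum => j _; exact: HP.
rewrite sumEFin lee_fin -mulr_sumr ler_wpM2l //.
rewrite -[leRHS]mul1r ler_pdivlMr ?subr_gt0 //.
by have := subrX1 q J; have := exprn_ge0 J q0; lra.
Qed.

End ExpectedHitting.

Lemma count_of_step (V : finType) b (a : cell_move V) (x : state V) :
  (count_of b x <= (count_of b (step a x)).+1)%N.
Proof.
case: a => [[v m]|] /=; last exact: leqnSn.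
rewrite count_of_update; case: ifP => _; first exact: leqnSn.
case: ifP => _; first by rewrite -ltnS; case: (count_of b x).
by rewrite (leq_trans (leqnSn _)).
Qed.

(** One move changes the count by at most one, so the level U cannot be jumped over on the way
    down. *)
Lemma visits_level (V : finType) b (U : nat) (x : state V) c :
  (U <= count_of b x)%N ->
  visits (fun y => count_of b y <= U)%N x c -> visits (fun y => count_of b y == U) x c.
Proof.
elim: c x => [|a c IH] x Ux /=.
  by rewrite !orbF => xU; rewrite eqn_leq xU.
case/orP => [xU|H]; first by rewrite eqn_leq xU Ux.
have [//|xU /=] := eqVneq (count_of b x) U.
apply: IH H; rewrite -ltnS; apply: leq_trans (count_of_step b a x).
by rewrite ltn_neqAle eq_sym xU.
Qed.

Section LevelHitting.
Variables (R : realType) (V : finType) (e : rel V) (alpha : R).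
Hypotheses (alpha01 : 0 <= alpha <= 1) (deg_gt0 : forall v, (0 < degree e v)%N).
Variables (d : measure_display) (Omega : measurableType d).
Variables (P : probability Omega R) (x : state V) (X : R -> Omega -> state V).
Hypothesis HX : two_choices e alpha P x X.

Let n : R := #|V|%:R.

(** The multiple 2 / n of the count is at least 1 above U and at most 2 everywhere. As the count is
    at most n, a drift of - r n is also at most - r times the count, hence exponential decay. *)
Lemma level_hitting (b : bool) (U : nat) (r : R) : 0 < r -> 0 < n ->
  n <= 2 * U%:R -> (U <= count_of b x)%N ->
  (forall y, (U < count_of b y)%N ->
     rate_to e alpha b y - rate_to e alpha (~~ b) y <= - r * n) ->
  (\int[P]_w hitting_time X [set y | count_of b y = U] w
     <= (2 / (1 - expR (- r)))%:E)%E.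
Proof.
move=> r0 n0 nU Ux drift.
have q1 : 0 <= expR (- r) < 1 by rewrite expR_ge0 expR_lt1 oppr_lt0.
pose f (y : state V) : R := 2 / n * (count_of b y)%:R.
have f2 y : f y <= 2.
  by rewrite /f mulrAC ler_pdivrMr // ler_wpM2l // count_of_le.
(* The term j = 0 is bounded trivially, since [avoid_probability] asks for a positive time. *)
apply: (expected_hitting_le HX) => // [[|j]].
  rewrite expr0 mulr1; apply: le_trans (probability_le1 _ _) _.
    exact: (avoids_measurable HX).
  by rewrite lee_fin; lra.
apply: (@le_trans _ _ (expR (- (r * j.+1%:R)) * f x)%:E); last first.
  rewrite lee_fin mulrC -expRM_natl mulrN (mulrC _ r).
  by rewrite ler_wpM2r // expR_ge0.
apply: (@avoid_probability R V e alpha alpha01 deg_gt0 _ _ P x X HX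
  (fun y => count_of b y <= U)%N (fun y => count_of b y == U) f r j.+1%:R) => //.
- exact: (avoids_measurable HX).
- by move=> w _ H s sj; apply/eqP; apply: H.
- by move=> c; apply: visits_level.
- by move=> y; rewrite /f mulr_ge0 // divr_ge0 // ltW.
- move=> y; rewrite -ltnNge => Uy; rewrite /f mulrAC ler_pdivlMr // mul1r.
  by apply: le_trans nU _; rewrite ler_wpM2l // ler_nat ltnW.
- move=> y; rewrite -ltnNge => Uy; rewrite /f.
  rewrite (generator_count e alpha b (fun a => 2 / n * a%:R)) //.
  have u0 : 0 <= 2 / n by rewrite divr_ge0 // ltW.
  have := drift y Uy; have := count_of_le R b y; rewrite -/n.
  case: (count_of b y) Uy => // a _ an dr /=.
  have H1 := ler_wpM2l u0 dr.
  have H2 : r * (2 / n) * a.+1%:R <= r * (2 / n) * n by rewrite ler_wpM2l // mulr_ge0 // ltW.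
  have -> : a.+2%:R = a.+1%:R + 1 :> R by rewrite natr1.
  have -> : a%:R = a.+1%:R - 1 :> R by rewrite -natr1 addrK.
  move: H1 H2; move: (2 / n) (a.+1%:R : R) => u a1; lra.
Qed.

End LevelHitting.

(** 1 - 2 p <= - eps, while the second factor is smallest at p = 1/2, where it equals (3 alpha - 1)
    / 4 > 0. *)
Lemma limit_drift_consensus (R : realType) (alpha eps p : R) :
  3^-1 < alpha < 1 -> 0 < eps -> (1 + eps) / 2 <= p ->
  limit_drift alpha p <= - (eps * (3 * alpha - 1) / 4).
Proof.
move=> /andP[a0 a1] e0 ep; rewrite /limit_drift.
have H : (3 * alpha - 1) / 4 <= alpha / 2 - (1 - alpha) * (p * (1 - p)).
  have : p * (1 - p) <= 1 / 4 by nra.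
  move: (p * (1 - p)) => q; nra.
move: H; move: (_ - _ * (p * _)) => z H; nra.
Qed.

Section FastFamily.
Variables (R : realType) (V : nat -> finType) (e : forall k, rel (V k)).
Arguments e : clear implicits.
Variable alpha : R.
Variables (d : nat -> measure_display) (Omega : forall k, measurableType (d k)).
Variables (P : forall k, state (V k) -> probability (Omega k) R).
Arguments P : clear implicits.
Variables (X : forall k, R -> Omega k -> state (V k)).
Arguments X : clear implicits.
Hypothesis hexpander : expander_family R e.
Hypothesis hlambda : (fun k => second_eigenvalue R (e k)) @ \oo --> (0 : R).
Hypothesis hdegree :
  (fun k => (max_degree (e k))%:R / (min_degree (e k))%:R : R) @ \oo --> (1 : R).
Hypothesis halpha : 0 < alpha < 1.
Hypothesis hX : forall k x, two_choices (e k) alpha (P k x) x (X k).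

Let n k : R := #|V k|%:R.

Lemma fast_level_hitting (eps : R) : 3^-1 < alpha -> 0 < eps ->
  exists2 K : R, 0 < K & \forall k \near \oo,
    forall (b : bool) (U : nat) (x : state (V k)),
      (1 + eps) / 2 * n k <= U%:R -> (U <= count_of b x)%N ->
      (\int[P k x]_w hitting_time (X k) [set y | count_of b y = U] w <= K%:E)%E.
Proof.
move=> a3 eps0; case/andP: (halpha) => a0 a1.
have alpha01 : 0 <= alpha <= 1 by rewrite !ltW.
have a3' : 0 < 3 * alpha - 1 by have : 3 * 3^-1 < 3 * alpha; [rewrite ltr_pM2l|rewrite divff //; lra].
(* Half of the bound of [limit_drift_consensus]; the other half absorbs the error of
   [family_drift]. *)
pose r := eps * (3 * alpha - 1) / 8.
have r0 : 0 < r by rewrite divr_gt0 // mulr_gt0.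
exists (2 / (1 - expR (- r))); first by rewrite divr_gt0 // subr_gt0 expR_lt1 oppr_lt0.
have := family_drift hexpander hlambda hdegree alpha01 r0.
apply: filterS => k drift b U x Un Ux.
have n0 : 0 < n k by rewrite ltr0n; apply: leq_ltn_trans (family_size hexpander k).
have deg v := family_degree_gt0 hexpander (k := k) v.
apply: (level_hitting alpha01 deg (hX x) r0 n0) => //.
  rewrite -/(n k); have : 0 < eps * n k by rewrite mulr_gt0.
  by lra.
move=> y Uy; pose p := (count_of b y)%:R / n k.
have pE : n k * p = (count_of b y)%:R by rewrite mulrC divfK // gt_eqF.
have := drift b y p pE; rewrite ler_norml => /andP[_].
have : limit_drift alpha p <= - (eps * (3 * alpha - 1) / 4).
  apply: limit_drift_consensus => //; first by rewrite a3.
  by rewrite ler_pdivlMr //; apply: le_trans Un _; rewrite ler_nat ltnW.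
rewrite -/(n k) => H1; have := ler_wpM2l (ltW n0) H1; rewrite /r; lra.
Qed.

(** Having at most L ones means having at least n - L zeros, so on either side the majority opinion
    has to descend to a level. *)
Lemma outside_band_level (eps : R) k (x : state (V k)) : 0 < eps -> outside_band eps x ->
  exists b U, [/\ (1 + eps) / 2 * n k <= U%:R, (U <= count_of b x)%N &
    [set y : state (V k) | count_of b y = U] `<=` band_boundary eps].
Proof.
move=> eps0; rewrite /outside_band /= count_onesE => -[xl|xu].
  have [L LE] : exists L : nat, lower_level (V k) eps = L%:Z.
    by case: (lower_level _ _) xl => // L _; exists L.
  have Llo : L%:R <= n k / 2 * (1 - eps) :> R.
    by have := floor_le (n k / 2 * (1 - eps)); rewrite -/(lower_level (V k) eps) LE.
  have Ln : (L <= #|V k|)%N.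
    rewrite -(ler_nat R); apply: le_trans Llo _; have n0 : 0 <= n k by [].
    by rewrite -/(n k); nra.
  have cN (y : state (V k)) : (count_of true y + count_of false y = #|V k|)%N.
    by apply/eqP; rewrite -(eqr_nat R) natrD (count_ofN R true) addrC subrK.
  rewrite LE lez_nat in xl.
  exists false, (#|V k| - L)%N; split.
  - by rewrite natrB // -/(n k); lra.
  - by rewrite leq_subLR -(cN x) leq_add2r.
  - move=> y /= yU; right; rewrite LE count_onesE; congr Posz.
    by rewrite -(addnK (count_of false y) (count_of true y)) cN yU subKn.
have [U UE] : exists U : nat, upper_level (V k) eps = U%:Z.
  have : 0 <= upper_level (V k) eps.
    by rewrite ceil_ge0; apply: lt_le_trans (_ : 0 <= _); rewrite ?ltrN10 // mulr_ge0 //; lra.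
  by case: (upper_level _ _) => // U _; exists U.
exists true, U; split.
- have := ceil_ge (n k / 2 * (1 + eps)); rewrite -/(upper_level (V k) eps) UE.
  by apply: le_trans; rewrite mulrAC -mulrA mulrC.
- by rewrite UE lez_nat in xu.
- by move=> y /= yU; left; rewrite UE count_onesE yU.
Qed.

Lemma boundary_sub_band (eps : R) k : 0 < eps -> 
  @band_boundary R (V k) eps `<=` @band R (V k) eps.
Proof.
move=> eps0; have lu : lower_level (V k) eps <= upper_level (V k) eps.
  rewrite -(ler_int R); apply: le_trans (floor_le _) (le_trans _ (ceil_ge _)).
  by rewrite ler_wpM2l ?divr_ge0 //; lra.
by move=> y [] yE; rewrite /band /= yE lexx lu.
Qed.

Lemma fast_hitting (eps : R) : 3^-1 < alpha -> 0 < eps ->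
  exists2 C : R, 0 < C &
    \forall k \near \oo, forall x : state (V k),
      (outside_band eps x ->
         (\int[P k x]_w hitting_time (X k) (@band_boundary R (V k) eps) w
            <= (C * ln #|V k|%:R)%:E)%E) /\
      (\int[P k x]_w hitting_time (X k) (@band R (V k) eps) w
         <= (C * ln #|V k|%:R)%:E)%E.
Proof.
move=> a3 eps0; have [K K0 fast] := fast_level_hitting a3 eps0.
have ln2 : 0 < ln 2 :> R by rewrite ln_gt0 // ltr1n.
(* The expectation is bounded by the constant K, and ln n >= ln 2 since n >= 2. *)
exists (K / ln 2); first by rewrite divr_gt0.
apply: filterS fast => k fast x.
have Kln : K <= K / ln 2 * ln #|V k|%:R.
  have [/(_ k)[V1 _] _ _] := hexpander.
  rewrite -mulrA ler_peMr ?(ltW K0) // mulrC ler_pdivlMr // mul1r.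
  by rewrite ler_ln ?posrE ?ltr0n ?ler_nat //; apply: ltnW.
have boundary : outside_band eps x ->
    (\int[P k x]_w hitting_time (X k) (@band_boundary R (V k) eps) w
       <= (K / ln 2 * ln #|V k|%:R)%:E)%E.
  move=> /(outside_band_level eps0)[b [U [Un Ux UB]]].
  apply: (@le_trans _ _ K%:E); last by rewrite lee_fin.
  apply: le_trans (fast b U x Un Ux).
  apply: ge0_integral_mono; first exact: hitting_time_ge0.
  by move=> w; apply: hitting_time_mono.
split=> //; have [xout|xin] := pselect (outside_band eps x).
  apply: le_trans (boundary xout).
  apply: ge0_integral_mono; first exact: hitting_time_ge0.
  by move=> w; apply: hitting_time_mono; apply: boundary_sub_band.
have xband : band eps x.
  rewrite /band /=; move: xin; rewrite /outside_band /= => /not_orP[].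
  by move=> /negP; rewrite -ltNge => /ltW -> /negP; rewrite -ltNge => /ltW ->.
(* From inside the band every avoidance event is null, so the geometric bound applies with both
   constants 0. *)
apply: (@le_trans _ _ (0 / (1 - 0))%:E); last first.
  by rewrite mul0r lee_fin; apply: le_trans Kln; apply: ltW.
apply: (expected_hitting_le (hX x)) => //; first by rewrite lexx ltr01.
move=> j; rewrite mul0r (probability_on_start (hX x)); last exact: (avoids_measurable (hX x)).
rewrite (_ : _ `&` _ = set0) ?measure0 //.
apply/seteqP; split=> // w [/= av Xx]; apply: (av 0); first by rewrite lexx ler0n.
by rewrite Xx.
Qed.

End FastFamily.

Theorem corollary5p2 (R : realType) (V : nat -> finType)
    (e : forall k, rel (V k)) (alpha : R)
    (d : nat -> measure_display) (Omega : forall k, measurableType (d k))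
    (P : forall k, state (V k) -> probability (Omega k) R)
    (X : forall k, R -> Omega k -> state (V k))
    (pi : forall k, state (V k) -> R)
    (hexpander : expander_family R e)
    (hlambda : (fun k => second_eigenvalue R (e k)) @ \oo --> (0 : R))
    (hdegree : (fun k => (max_degree (e k))%:R / (min_degree (e k))%:R : R)
                 @ \oo --> (1 : R))
    (halpha : 0 < alpha < 1)
    (hX : forall k x, two_choices (e k) alpha (P k x) x (X k))
    (hpi : forall k, stationary_distribution (P k) (X k) (pi k)) :
  (alpha < 3^-1 ->
     Omega_exp_Theta (fun k => #|V k|)
                     (fun k => mixing_time (P k) (X k) (pi k)) /\
     forall eps : R, 0 < eps ->
       exists (g : nat -> R) (c : R),
         [/\ pos_Theta (fun k => #|V k|) g, 0 < c &
         forall p : R, 0 <= p < 2^-1 - eps \/ 2^-1 + eps < p <= 1 ->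
         forall x : forall k, state (V k),
           (forall k, (count_ones (x k))%:Z = Num.ceil (#|V k|%:R * p)) ->
           (fun k => P k (x k)
              [set w | ((c * expR (g k))%:E <=
                        hitting_time (X k) (@half_level (V k)) w)%E])
             @ \oo --> 1%E]) /\
  (3^-1 < alpha ->
     forall eps : R, 0 < eps ->
       exists2 C : R, 0 < C &
         \forall k \near \oo, forall x : state (V k),
           (outside_band eps x ->
              (\int[P k x]_w hitting_time (X k) (@band_boundary R (V k) eps) w
                 <= (C * ln #|V k|%:R)%:E)%E) /\
           (\int[P k x]_w hitting_time (X k) (@band R (V k) eps) w
              <= (C * ln #|V k|%:R)%:E)%E).
Proof.
split=> a3; last by move=> eps eps0; exact: (fast_hitting hexpander hlambda hdegree halpha hX).
split; first exact: (slow_mixing pi hexpander hlambda hdegree halpha hX).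
by move=> eps eps0; exact: (slow_hitting hexpander hlambda hdegree halpha hX).
Qed.
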